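(* Let $k$ be an algebraically closed field of characteristic $p>0$. Let $Q$ be a finite quiver, let $I_1\supseteq I_2\supseteq\cdots$ be a chain of closed relation ideals of the completed path algebra $k[[Q]]$, and set $I=\bigcap_{n\in\mathbb N}I_n$. For each $n\in\mathbb N$, let $\rho_{n,n+1}:k[[Q]]/I_{n+1}\to k[[Q]]/I_n$ be a surjective algebra homomorphism (not necessarily the natural projection), and whenever $m\le n$ define $\rho_{mn}=\rho_{m,m+1}\rho_{m+1,m+2}\cdots\rho_{n-1,n}$, so that $\{k[[Q]]/I_n,\rho_{mn}\}$ is an inverse system of algebras. Then $$\varprojlim_{n\in\mathbb N}\{k[[Q]]/I_n,\rho_{mn}\}\cong k[[Q]]/I.$$
   Context: A finite quiver is a finite directed graph, with loops and multiple edges allowed. For $n\ge0$ let $kQ_n$ be the $k$-vector space with basis the paths of length $n$ in $Q$. The completed path algebra is $k[[Q]]=\prod_{n\ge0}kQ_n$ (product topology, with each $kQ_n$ discrete), with multiplication given by concatenation of composable paths (product $0$ if not composable). Its Jacobson radical $J$ satisfies $J^s=\prod_{n\ge s}kQ_n$ for $s\geq 1$. A relation ideal of $k[[Q]]$ is a closed ideal contained in $J^2$. *)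

(* Defs.v *)
From HB Require Import structures.
From mathcomp Require Import all_boot all_order all_algebra.
From mathcomp Require Import all_classical topology.

Set Implicit Arguments.
Unset Strict Implicit.
Unset Printing Implicit Defensive.

Import GRing.Theory.
Local Open Scope ring_scope.
Local Open Scope quotient_scope.

(* MathComp's [lalgType] and [algType] exclude the zero ring, which is the path
   algebra of the empty quiver.  Algebras are therefore carried here by types
   that are both a [pzRingType] and an [lmodType k]. *)

Record quiver := Quiver {
  vertex : finType;
  arrow : finType;
  source : arrow -> vertex;
  target : arrow -> vertex }.

Section Paths.
Variable Q : quiver.

Fixpoint is_walk (v : vertex Q) (s : seq (arrow Q)) : bool :=
  if s is e :: s' then (source e == v) && is_walk (target e) s' else true.

Definition walk_end (v : vertex Q) (s : seq (arrow Q)) : vertex Q :=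
  last v (map (@target Q) s).

(* The start vertex is recorded so that there is one trivial path of length 0
   at each vertex. *)
Definition qpath (n : nat) :=
  {p : vertex Q * n.-tuple (arrow Q) | is_walk p.1 p.2}.

Definition path_arrows n (p : qpath n) : seq (arrow Q) := (val p).2.
Definition path_source n (p : qpath n) : vertex Q := (val p).1.
Definition path_target n (p : qpath n) : vertex Q :=
  walk_end (path_source p) (path_arrows p).

(* [p] and [q] are composable and [r] is their concatenation, [p] being
   traversed first. *)
Definition is_concat i j n (p : qpath i) (q : qpath j) (r : qpath n) : bool :=
  [&& path_target p == path_source q,
      path_source r == path_source p &
      path_arrows r == path_arrows p ++ path_arrows q].

Lemma is_walk_cat v s t :
  is_walk v (s ++ t) = is_walk v s && is_walk (walk_end v s) t.
Proof. by elim: s v => //= e s IH v; rewrite IH andbA. Qed.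

Lemma walk_end_cat v s t : walk_end v (s ++ t) = walk_end (walk_end v s) t.
Proof. by rewrite /walk_end map_cat last_cat. Qed.

End Paths.

Section PathAlgebra.
Variables (k : fieldType) (Q : quiver).

Definition pathspace (n : nat) := {ffun qpath Q n -> k}.

Definition pathalg := forall n : nat, pathspace n.

HB.instance Definition _ := Topological.copy pathalg
  (prod_topology (fun n : nat => discrete_topology (pathspace n))).

Implicit Types a b c : pathalg.

Lemma pathalg_ext a b : (forall n p, a n p = b n p) -> a = b.
Proof. by move=> ab; apply: functional_extensionality_dep => n; apply/ffunP. Qed.

Definition pa_zero : pathalg := fun n => 0.
Definition pa_opp a : pathalg := fun n => - a n.
Definition pa_add a b : pathalg := fun n => a n + b n.
Definition pa_scale (x : k) a : pathalg := fun n => [ffun p => x * a n p].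
(* the sum of the trivial paths *)
Definition pa_one : pathalg := fun n => [ffun=> (n == 0)%N%:R].
Definition pa_mul a b : pathalg := fun n =>
  [ffun r => \sum_(i < n.+1)
     \sum_(pq : qpath Q i * qpath Q (n - i) | is_concat pq.1 pq.2 r)
        a i pq.1 * b (n - i)%N pq.2].

Lemma pa_addA : associative pa_add.
Proof. by move=> a b c; apply: pathalg_ext => n p; rewrite !ffunE addrA. Qed.

Lemma pa_addC : commutative pa_add.
Proof. by move=> a b; apply: pathalg_ext => n p; rewrite !ffunE addrC. Qed.

Lemma pa_add0 : left_id pa_zero pa_add.
Proof. by move=> a; apply: pathalg_ext => n p; rewrite !ffunE add0r. Qed.

Lemma pa_addN : left_inverse pa_zero pa_opp pa_add.
Proof. by move=> a; apply: pathalg_ext => n p; rewrite !ffunE addNr. Qed.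

HB.instance Definition _ :=
  GRing.isZmodule.Build pathalg pa_addA pa_addC pa_add0 pa_addN.

(* [wcoef a v s] is the coefficient in [a] of the path starting at [v] with
   sequence of arrows [s], and 0 if there is no such path. *)
Definition wcoef a (v : vertex Q) (s : seq (arrow Q)) : k :=
  if insub (v, in_tuple s) is Some p then a (size s) p else 0.

Lemma wcoefE a n (p : qpath Q n) : a n p = wcoef a (path_source p) (path_arrows p).
Proof.
case: p => -[v [s sz]] /= w; rewrite /path_source /path_arrows /wcoef /=.
have sE := eqP sz; case: n / sE sz w => sz w.
rewrite insubT /=; congr (a _ _); apply: val_inj => /=.
by congr (_, _); apply: val_inj.
Qed.

Lemma wcoef_out a v s : ~~ is_walk v s -> wcoef a v s = 0.
Proof. by move=> w; rewrite /wcoef insubN. Qed.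

Lemma wcoef_in a v s (w : is_walk v s) :
  wcoef a v s = a (size s) (exist _ (v, in_tuple s) w).
Proof. by rewrite wcoefE. Qed.

Lemma wcoef_inj a b : (forall v s, wcoef a v s = wcoef b v s) -> a = b.
Proof. by move=> ab; apply: pathalg_ext => n p; rewrite !wcoefE. Qed.

Lemma wcoefD a b v s : wcoef (pa_add a b) v s = wcoef a v s + wcoef b v s.
Proof.
have [w|w] := boolP (is_walk v s); last by rewrite !wcoef_out ?addr0.
by rewrite !(wcoef_in _ w) ffunE.
Qed.

Lemma wcoefZ x a v s : wcoef (pa_scale x a) v s = x * wcoef a v s.
Proof.
have [w|w] := boolP (is_walk v s); last by rewrite !wcoef_out ?mulr0.
by rewrite !(wcoef_in _ w) ffunE.
Qed.

Lemma wcoef1 v s : wcoef pa_one v s = (size s == 0)%N%:R.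
Proof.
have [w|] := boolP (is_walk v s); first by rewrite (wcoef_in _ w) ffunE.
by case: s => [|e s] // w; rewrite wcoef_out.
Qed.

Lemma wcoefM a b v s : wcoef (pa_mul a b) v s =
  \sum_(0 <= i < (size s).+1)
     wcoef a v (take i s) * wcoef b (walk_end v (take i s)) (drop i s).
Proof.
have [w|w] := boolP (is_walk v s); last first.
  rewrite wcoef_out // big1 // => i _.
  move: w; rewrite -{1}(cat_take_drop i s) is_walk_cat negb_and.
  by case/orP => w; rewrite (wcoef_out _ w) ?mul0r ?mulr0.
rewrite (wcoef_in _ w) ffunE big_mkord; apply: eq_bigr => i _.
have ile : (i <= size s)%N by rewrite -ltnS.
have := w; rewrite -{1}(cat_take_drop i s) is_walk_cat => /andP[w1 w2].
have sz1 : size (take i s) == i by rewrite size_takel.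
have sz2 : size (drop i s) == (size s - i)%N by rewrite size_drop.
pose p0 : qpath Q i := exist _ (v, Tuple sz1) w1.
pose q0 : qpath Q (size s - i) :=
  exist _ (walk_end v (take i s), Tuple sz2) w2.
rewrite (big_pred1 (p0, q0)); first by rewrite !wcoefE.
case=> p q; rewrite /= xpair_eqE; apply/and3P/andP.
- case=> /eqP pq /eqP vE /eqP sE.
  have pE : path_arrows p = take i s.
    by have := congr1 (take i) sE; rewrite take_size_cat ?size_tuple.
  have qE : path_arrows q = drop i s.
    by have := congr1 (drop i) sE; rewrite drop_size_cat ?size_tuple.
  have p_eq : p = p0.
    case: p vE pE {pq sE} => -[v' t] /= wp; rewrite /path_source /path_arrows /=.
    by move=> vE pE; apply: val_inj; rewrite /= -vE; congr (_, _); apply: val_inj.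
  rewrite p_eq eqxx; split=> //; apply/eqP.
  move: pq; rewrite p_eq; case: q qE {sE} => -[v' t] /= wq.
  rewrite /path_target /path_source /path_arrows /= => qE wE.
  by apply: val_inj; rewrite /= -wE; congr (_, _); apply: val_inj.
- case=> /eqP -> /eqP ->; split=> //.
  by rewrite /path_arrows /= cat_take_drop.
Qed.

Lemma pa_mulA : associative pa_mul.
Proof.
move=> a b c; apply: wcoef_inj => v s; rewrite !wcoefM.
pose F j i := wcoef a v (take j s) *
  wcoef b (walk_end v (take j s)) (drop j (take i s)) *
  wcoef c (walk_end v (take i s)) (drop i s).
transitivity (\sum_(0 <= j < (size s).+1) \sum_(j <= i < (size s).+1) F j i).
- apply: eq_big_nat => j /andP[_]; rewrite ltnS => jle.
  rewrite wcoefM big_distrr /= -[j in RHS]add0n big_addn add0n size_drop subSn //.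
  apply: eq_bigr => i _; rewrite mulrA /F.
  have ts : take (i + j) s = take j s ++ take i (drop j s).
    by rewrite addnC takeD.
  by rewrite ts walk_end_cat drop_size_cat ?size_takel // drop_drop.
- transitivity (\sum_(0 <= i < (size s).+1) \sum_(0 <= j < i.+1) F j i).
    transitivity (\sum_(0 <= j < (size s).+1)
        \sum_(0 <= i < (size s).+1 | (j <= i)%N) F j i).
      by apply: eq_bigr => j _; rewrite (big_nat_widenl j 0%N).
    rewrite (exchange_big_dep_nat xpredT) //=.
    apply: eq_big_nat => i /andP[_ ilt].
    by rewrite [RHS](big_nat_widen _ _ (size s).+1).
  apply: eq_big_nat => i /andP[_]; rewrite ltnS => ile.
  rewrite wcoefM big_distrl /= size_takel //.
  apply: eq_big_nat => j /andP[_]; rewrite ltnS => jle.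
  by rewrite /F take_takel.
Qed.

Lemma pa_mul1l : left_id pa_one pa_mul.
Proof.
move=> a; apply: wcoef_inj => v s; rewrite wcoefM big_nat_recl //.
rewrite wcoef1 take0 drop0 mul1r big_nat big1 ?addr0 // => i /andP[_ ilt].
by rewrite wcoef1 size_takel // mul0r.
Qed.

Lemma pa_mul1r : right_id pa_one pa_mul.
Proof.
move=> a; apply: wcoef_inj => v s; rewrite wcoefM big_nat_recr //=.
rewrite wcoef1 take_size drop_size mulr1 big_nat big1 ?add0r // => i /andP[_ ilt].
by rewrite wcoef1 size_drop subn_eq0 leqNgt ilt mulr0.
Qed.

Lemma pa_mulDl : left_distributive pa_mul +%R.
Proof.
move=> a b c; apply: wcoef_inj => v s; rewrite wcoefD !wcoefM -big_split.
by apply: eq_bigr => i _; rewrite wcoefD mulrDl.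
Qed.

Lemma pa_mulDr : right_distributive pa_mul +%R.
Proof.
move=> a b c; apply: wcoef_inj => v s; rewrite wcoefD !wcoefM -big_split.
by apply: eq_bigr => i _; rewrite wcoefD mulrDr.
Qed.

HB.instance Definition _ := GRing.Zmodule_isPzRing.Build pathalg
  pa_mulA pa_mul1l pa_mul1r pa_mulDl pa_mulDr.

Lemma pa_scaleA x y a : pa_scale x (pa_scale y a) = pa_scale (x * y) a.
Proof. by apply: pathalg_ext => n p; rewrite !ffunE mulrA. Qed.

Lemma pa_scale1 : left_id 1 pa_scale.
Proof. by move=> a; apply: pathalg_ext => n p; rewrite !ffunE mul1r. Qed.

Lemma pa_scaleDr : right_distributive pa_scale +%R.
Proof. by move=> x a b; apply: pathalg_ext => n p; rewrite !ffunE mulrDr. Qed.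

Lemma pa_scaleDl a : {morph pa_scale^~ a : x y / x + y}.
Proof. by move=> x y; apply: pathalg_ext => n p; rewrite !ffunE mulrDl. Qed.

HB.instance Definition _ := GRing.Zmodule_isLmodule.Build k pathalg
  pa_scaleA pa_scale1 pa_scaleDr pa_scaleDl.

Lemma pa_scaleAl (x : k) a b : x *: (a * b) = x *: a * b.
Proof.
apply: wcoef_inj => v s; rewrite wcoefZ !wcoefM big_distrr /=.
by apply: eq_bigr => i _; rewrite wcoefZ mulrA.
Qed.

Lemma pa_scaleAr (x : k) a b : x *: (a * b) = a * (x *: b).
Proof.
apply: wcoef_inj => v s; rewrite wcoefZ !wcoefM big_distrr /=.
by apply: eq_bigr => i _; rewrite wcoefZ mulrCA.
Qed.

End PathAlgebra.

Section Ideals.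
Local Open Scope classical_set_scope.
Variable R : pzRingType.
Implicit Types X Y M N : set R.

Definition left_ideal X : Prop :=
  [/\ X 0, forall x y, X x -> X y -> X (x + y) & forall a x, X x -> X (a * x)].

Definition two_sided_ideal X : Prop :=
  left_ideal X /\ forall x a, X x -> X (x * a).

Definition maximal_left_ideal M : Prop :=
  [/\ left_ideal M, M <> setT &
      forall N, left_ideal N -> M `<=` N -> N = M \/ N = setT].

Definition jacobson_radical : set R :=
  [set x | forall M, maximal_left_ideal M -> M x].

Definition ideal_mul X Y : set R :=
  [set x | exists n (a b : 'I_n -> R),
     [/\ forall i, X (a i), forall i, Y (b i) & x = \sum_(i < n) a i * b i]].

Record ideal := Ideal {
  ideal_set :> set R;
  idealP : two_sided_ideal ideal_set }.

Lemma ideal_bigcap_subproof (I : nat -> ideal) :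
  two_sided_ideal (\bigcap_n ideal_set (I n)).
Proof.
split; first split.
- by move=> n _; case: (idealP (I n)) => -[].
- by move=> x y Ix Iy n _; case: (idealP (I n)) => -[_ D _] _;
    apply: D; [apply: Ix | apply: Iy].
- by move=> a x Ix n _; case: (idealP (I n)) => -[_ _ M] _; apply/M/Ix.
- by move=> x a Ix n _; case: (idealP (I n)) => _ M; apply/M/Ix.
Qed.

Definition ideal_bigcap (I : nat -> ideal) : ideal :=
  Ideal (ideal_bigcap_subproof I).

Definition mem_ideal (I : ideal) : {pred R} := fun x => `[< ideal_set I x >].

Lemma mem_idealP (I : ideal) x : reflect (ideal_set I x) (x \in mem_ideal I).
Proof. exact: asboolP. Qed.

Lemma mem_ideal_zmod_closed I : zmod_closed (mem_ideal I).
Proof.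
case: (idealP I) => -[I0 ID IM] _; split; first exact/mem_idealP.
move=> x y /mem_idealP Ix /mem_idealP Iy; apply/mem_idealP; apply: ID => //.
by rewrite -mulN1r; apply: IM.
Qed.

HB.instance Definition _ I :=
  GRing.isZmodClosed.Build R (mem_ideal I) (mem_ideal_zmod_closed I).

Lemma mem_idealMl I a x : x \in mem_ideal I -> a * x \in mem_ideal I.
Proof.
by move/mem_idealP=> Ix; apply/mem_idealP; case: (idealP I) => -[_ _ M] _; apply: M.
Qed.

Lemma mem_idealMr I x a : x \in mem_ideal I -> x * a \in mem_ideal I.
Proof.
by move/mem_idealP=> Ix; apply/mem_idealP; case: (idealP I) => _ M; apply: M.
Qed.

End Ideals.

Arguments jacobson_radical R : clear implicits.

Section RingQuotient.
Variables (R : pzRingType) (I : ideal R).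

(* MathComp's quotient of Z-modules; its ring structure is only provided there
   for commutative rings. *)
Definition ringquot := Quotient.quot (mem_ideal I).

HB.instance Definition _ := GRing.Zmodule.on ringquot.
HB.instance Definition _ : EqQuotient R (Quotient.equiv (mem_ideal I)) ringquot :=
  EqQuotient.on ringquot.

Definition ringquot_pi (x : R) : ringquot := \pi_ringquot x.

Lemma ringquot_piP x y : reflect (ringquot_pi x = ringquot_pi y) (x - y \in mem_ideal I).
Proof. by rewrite Quotient.idealrBE; apply: eqP. Qed.

Lemma ringquot_piD x y : ringquot_pi (x + y) = ringquot_pi x + ringquot_pi y.
Proof. by rewrite /ringquot_pi raddfD. Qed.

Lemma ringquot_reprK (x : ringquot) : ringquot_pi (repr x) = x.
Proof. exact: reprK. Qed.

Definition rq_one : ringquot := ringquot_pi 1.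
Definition rq_mul (x y : ringquot) : ringquot := ringquot_pi (repr x * repr y).

Lemma rq_mulE x y : rq_mul (ringquot_pi x) (ringquot_pi y) = ringquot_pi (x * y).
Proof.
apply/ringquot_piP; set x' := repr _; set y' := repr _.
have -> : x' * y' - x * y = (x' - x) * y' + x * (y' - y).
  by rewrite mulrBl mulrBr addrA subrK.
by apply: rpredD; [apply: mem_idealMr | apply: mem_idealMl];
  apply/ringquot_piP; rewrite ringquot_reprK.
Qed.

Lemma rq_mulA : associative rq_mul.
Proof.
move=> x y z; rewrite -[x]ringquot_reprK -[y]ringquot_reprK -[z]ringquot_reprK.
by rewrite !rq_mulE mulrA.
Qed.

Lemma rq_mul1l : left_id rq_one rq_mul.
Proof. by move=> x; rewrite -[x]ringquot_reprK rq_mulE mul1r. Qed.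

Lemma rq_mul1r : right_id rq_one rq_mul.
Proof. by move=> x; rewrite -[x]ringquot_reprK rq_mulE mulr1. Qed.

Lemma rq_mulDl : left_distributive rq_mul +%R.
Proof.
move=> x y z; rewrite -[x]ringquot_reprK -[y]ringquot_reprK -[z]ringquot_reprK.
by rewrite -ringquot_piD !rq_mulE mulrDl ringquot_piD.
Qed.

Lemma rq_mulDr : right_distributive rq_mul +%R.
Proof.
move=> x y z; rewrite -[x]ringquot_reprK -[y]ringquot_reprK -[z]ringquot_reprK.
by rewrite -ringquot_piD !rq_mulE mulrDr ringquot_piD.
Qed.

HB.instance Definition _ := GRing.Zmodule_isPzRing.Build ringquot
  rq_mulA rq_mul1l rq_mul1r rq_mulDl rq_mulDr.

End RingQuotient.

Section PathAlgebraQuotient.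
Variables (k : fieldType) (Q : quiver) (I : ideal (pathalg k Q)).

Definition pathquot := ringquot I.

HB.instance Definition _ := GRing.PzRing.on pathquot.

Implicit Types u v : pathquot.

Definition pq_scale (x : k) u : pathquot := ringquot_pi I (x *: repr u).

Lemma pq_scaleE x (a : pathalg k Q) :
  pq_scale x (ringquot_pi I a) = ringquot_pi I (x *: a).
Proof.
apply/ringquot_piP; rewrite -scalerBr -[_ - _]mul1r pa_scaleAl.
by apply: mem_idealMl; apply/ringquot_piP; rewrite ringquot_reprK.
Qed.

Lemma pq_scaleA x y u : pq_scale x (pq_scale y u) = pq_scale (x * y) u.
Proof. by rewrite -[u]ringquot_reprK !pq_scaleE scalerA. Qed.

Lemma pq_scale1 : left_id 1 pq_scale.
Proof. by move=> u; rewrite -[u]ringquot_reprK pq_scaleE scale1r. Qed.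

Lemma pq_scaleDr : right_distributive pq_scale +%R.
Proof.
move=> x u v; rewrite -[u]ringquot_reprK -[v]ringquot_reprK -ringquot_piD.
by rewrite !pq_scaleE scalerDr ringquot_piD.
Qed.

Lemma pq_scaleDl u : {morph pq_scale^~ u : x y / x + y}.
Proof.
by move=> x y; rewrite -[u]ringquot_reprK !pq_scaleE scalerDl ringquot_piD.
Qed.

HB.instance Definition _ := GRing.Zmodule_isLmodule.Build k pathquot
  pq_scaleA pq_scale1 pq_scaleDr pq_scaleDl.

Lemma pq_scaleAl (x : k) u v : x *: (u * v) = x *: u * v.
Proof.
rewrite -[u]ringquot_reprK -[v]ringquot_reprK.
by rewrite [_ * _]rq_mulE [LHS]pq_scaleE pa_scaleAl -rq_mulE -pq_scaleE.
Qed.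

Lemma pq_scaleAr (x : k) u v : x *: (u * v) = u * (x *: v).
Proof.
rewrite -[u]ringquot_reprK -[v]ringquot_reprK.
by rewrite [_ * _]rq_mulE [LHS]pq_scaleE pa_scaleAr -rq_mulE -pq_scaleE.
Qed.

End PathAlgebraQuotient.

Section RelationIdeal.
Variables (k : fieldType) (Q : quiver).

Definition relation_ideal (I : ideal (pathalg k Q)) : Prop :=
  closed (ideal_set I) /\
  (ideal_set I `<=` ideal_mul (jacobson_radical (pathalg k Q))
                              (jacobson_radical (pathalg k Q)))%classic.

Record quot_hom (I J : ideal (pathalg k Q)) := QuotHom {
  quot_hom_fun :> {rmorphism pathquot I -> pathquot J};
  quot_homZ : scalable quot_hom_fun }.

End RelationIdeal.

Section InverseLimit.
Variables (k : fieldType) (Q : quiver) (I : nat -> ideal (pathalg k Q)).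
Variable rho : forall n, quot_hom (I n.+1) (I n).

(* [rho_comp m d] is rho_(m,m+d) = rho_(m,m+1) ... rho_(m+d-1,m+d); a pair
   m <= n is written as (m, d + m), which makes the composite well typed. *)
Fixpoint rho_comp (m d : nat) : pathquot (I (d + m)) -> pathquot (I m) :=
  match d with
  | 0 => fun x => x
  | d'.+1 => fun x => rho_comp (rho (d' + m) x)
  end.

Record invlim := Invlim {
  thread : forall n, pathquot (I n);
  threadP : forall m d, rho_comp (thread (d + m)) = thread m }.

HB.instance Definition _ := gen_eqMixin invlim.
HB.instance Definition _ := gen_choiceMixin invlim.

Implicit Types x y z : invlim.

Lemma invlim_ext x y : (forall n, thread x n = thread y n) -> x = y.
Proof.
case: x y => [x xP] [y yP] /= xy.
have {}xy : x = y by apply: functional_extensionality_dep.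
by rewrite -xy in yP *; congr Invlim; apply: Prop_irrelevance.
Qed.

Lemma rho_comp0 m d : rho_comp (0 : pathquot (I (d + m))) = 0.
Proof. by elim: d => //= d IH; rewrite rmorph0. Qed.

Lemma rho_comp1 m d : rho_comp (1 : pathquot (I (d + m))) = 1.
Proof. by elim: d => //= d IH; rewrite rmorph1. Qed.

Lemma rho_compN m d (u : pathquot (I (d + m))) : rho_comp (- u) = - rho_comp u.
Proof. by elim: d u => //= d IH u; rewrite rmorphN IH. Qed.

Lemma rho_compD m d (u v : pathquot (I (d + m))) :
  rho_comp (u + v) = rho_comp u + rho_comp v.
Proof. by elim: d u v => //= d IH u v; rewrite rmorphD IH. Qed.

Lemma rho_compM m d (u v : pathquot (I (d + m))) :
  rho_comp (u * v) = rho_comp u * rho_comp v.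
Proof. by elim: d u v => //= d IH u v; rewrite rmorphM IH. Qed.

Lemma rho_compZ m d (c : k) (u : pathquot (I (d + m))) :
  rho_comp (c *: u) = c *: rho_comp u.
Proof. by elim: d u => //= d IH u; rewrite quot_homZ IH. Qed.

Definition il_zero : invlim :=
  @Invlim (fun n => 0) (fun m d => rho_comp0 m d).

Definition il_one : invlim :=
  @Invlim (fun n => 1) (fun m d => rho_comp1 m d).

Lemma il_oppP x m d : rho_comp (- thread x (d + m)) = - thread x m.
Proof. by rewrite rho_compN threadP. Qed.

Definition il_opp x : invlim :=
  @Invlim (fun n => - thread x n) (il_oppP x).

Lemma il_addP x y m d :
  rho_comp (thread x (d + m) + thread y (d + m)) = thread x m + thread y m.
Proof. by rewrite rho_compD !threadP. Qed.

Definition il_add x y : invlim :=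
  @Invlim (fun n => thread x n + thread y n) (il_addP x y).

Lemma il_mulP x y m d :
  rho_comp (thread x (d + m) * thread y (d + m)) = thread x m * thread y m.
Proof. by rewrite rho_compM !threadP. Qed.

Definition il_mul x y : invlim :=
  @Invlim (fun n => thread x n * thread y n) (il_mulP x y).

Lemma il_scaleP (c : k) x m d :
  rho_comp (c *: thread x (d + m)) = c *: thread x m.
Proof. by rewrite rho_compZ threadP. Qed.

Definition il_scale (c : k) x : invlim :=
  @Invlim (fun n => c *: thread x n) (il_scaleP c x).

Lemma il_addA : associative il_add.
Proof. by move=> x y z; apply: invlim_ext => n /=; rewrite addrA. Qed.

Lemma il_addC : commutative il_add.
Proof. by move=> x y; apply: invlim_ext => n /=; rewrite addrC. Qed.

Lemma il_add0 : left_id il_zero il_add.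
Proof. by move=> x; apply: invlim_ext => n /=; rewrite add0r. Qed.

Lemma il_addN : left_inverse il_zero il_opp il_add.
Proof. by move=> x; apply: invlim_ext => n /=; rewrite addNr. Qed.

HB.instance Definition _ :=
  GRing.isZmodule.Build invlim il_addA il_addC il_add0 il_addN.

Lemma il_mulA : associative il_mul.
Proof. by move=> x y z; apply: invlim_ext => n /=; rewrite mulrA. Qed.

Lemma il_mul1l : left_id il_one il_mul.
Proof. by move=> x; apply: invlim_ext => n /=; rewrite mul1r. Qed.

Lemma il_mul1r : right_id il_one il_mul.
Proof. by move=> x; apply: invlim_ext => n /=; rewrite mulr1. Qed.

Lemma il_mulDl : left_distributive il_mul +%R.
Proof. by move=> x y z; apply: invlim_ext => n /=; rewrite mulrDl. Qed.

Lemma il_mulDr : right_distributive il_mul +%R.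
Proof. by move=> x y z; apply: invlim_ext => n /=; rewrite mulrDr. Qed.

HB.instance Definition _ := GRing.Zmodule_isPzRing.Build invlim
  il_mulA il_mul1l il_mul1r il_mulDl il_mulDr.

Lemma il_scaleA c d x : il_scale c (il_scale d x) = il_scale (c * d) x.
Proof. by apply: invlim_ext => n /=; rewrite scalerA. Qed.

Lemma il_scale1 : left_id 1 il_scale.
Proof. by move=> x; apply: invlim_ext => n /=; rewrite scale1r. Qed.

Lemma il_scaleDr : right_distributive il_scale +%R.
Proof. by move=> c x y; apply: invlim_ext => n /=; rewrite scalerDr. Qed.

Lemma il_scaleDl x : {morph il_scale^~ x : c d / c + d}.
Proof. by move=> c d; apply: invlim_ext => n /=; rewrite scalerDl. Qed.

HB.instance Definition _ := GRing.Zmodule_isLmodule.Build k invlim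
  il_scaleA il_scale1 il_scaleDr il_scaleDl.

Lemma il_scaleAl (c : k) x y : c *: (x * y) = c *: x * y.
Proof. by apply: invlim_ext => n; apply: pq_scaleAl. Qed.

Lemma il_scaleAr (c : k) x y : c *: (x * y) = x * (c *: y).
Proof. by apply: invlim_ext => n; apply: pq_scaleAr. Qed.

End InverseLimit.

(* Main.v *)
Require Import Defs.
From HB Require Import structures.
From mathcomp Require Import all_boot all_order all_algebra.
From mathcomp Require Import closed_field.
From mathcomp Require Import all_classical topology.

(** Let [P] be the completed path algebra and [Fil s] the ideal of its elements
    without paths of length less than [s].  The quotient of [P] by [Fil s] is
    finite-dimensional, so the decreasing ideals [I n + Fil s] are constant for
    [n >= N s]; call [U s] their common value ([level] below).  The intersection
    of the [U s] is the intersection [I] of the closed ideals [I n], and [P / I]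
    is the limit of the finite-dimensional algebras [P / U s] along the natural
    projections.

    A homomorphism between quotients of [P] by ideals inside [Fil 1] respects the
    filtration ([qhom_Fil]).  Hence the composite of the given maps from level
    [N s.+1] to level [N s] induces a surjective endomorphism [tau s] of
    [P / U s], which is an automorphism for reasons of dimension, and the given
    inverse limit is the limit of the same algebras [P / U s] along the
    projections twisted by the [tau s].  The two limits are isomorphic as soon as
    there are automorphisms [beta s] of [P / U s] such that [beta s.+1] induces
    [beta s \o tau s] on [P / U s]: this is the vanishing of the first derived
    limit of the tower of groups [Aut (P / U s)] ([filtered_tower_twist]).

    It vanishes by the Mittag-Leffler argument ([group_tower_twist]), given that
    the candidates for [beta s] that extend to [m] further levels become
    independent of [m].  They form a decreasing chain of cosets in the algebraic
    group [Aut (P / U s)], described by equations and existential quantifiers.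
    Such a chain stabilises over an algebraically closed field
    ([coset_chain_stabilises]).  The polynomials vanishing on the cosets
    stabilise by Hilbert's basis theorem.  By quantifier elimination the cosets
    are constructible, and constructible sets on which the same polynomials
    vanish meet ([dense_definable_meet]).  If a coset and a smaller one have the
    same vanishing polynomials, then so do the smaller one and each of its
    translates inside the larger one; as they meet, there is only one such
    translate and the two cosets are equal. *)

Set Implicit Arguments.
Unset Strict Implicit.
Unset Printing Implicit Defensive.

Import GRing.Theory.
Local Open Scope ring_scope.

(** * Noetherian rings *)

Section Noetherian.

Definition noetherian (R : pzRingType) :=
  forall V : nat -> set R, (forall m, left_ideal (V m)) ->
    (forall m x, V m x -> V m.+1 x) -> exists m0, forall m x, V m x -> V m0 x.

Lemma chain_mono (T : Type) (V : nat -> set T) :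
  (forall m x, V m x -> V m.+1 x) -> forall i j x, (i <= j)%N -> V i x -> V j x.
Proof.
move=> VS i j x /subnK <-; elim: (j - i)%N => //= n IH Vx.
by rewrite addSn; apply/VS/IH.
Qed.

Lemma chain_anti (T : Type) (V : nat -> set T) :
  (forall m x, V m.+1 x -> V m x) -> forall i j x, (i <= j)%N -> V j x -> V i x.
Proof.
move=> VS i j x /subnK <-; elim: (j - i)%N => //= n IH.
by rewrite addSn => /VS/IH.
Qed.

Lemma left_idealB (R : pzRingType) (V : set R) x y :
  left_ideal V -> V x -> V y -> V (x - y).
Proof. by move=> [_ VD VM] Vx Vy; apply: VD => //; rewrite -mulN1r; apply: VM. Qed.

Lemma noetherian_field (k : fieldType) : noetherian k.
Proof.
move=> V Vid VS.
have [[m [x [Vx x0]]]|nV] := pselect (exists m x, V m x /\ x != 0).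
  exists m => m' y _; have [_ _ VM] := Vid m.
  by rewrite -(divfK x0 y); apply: VM.
exists 0%N => m x Vx; have [-> |x0] := eqVneq x 0; first by case: (Vid 0%N).
by case: nV; exists m, x.
Qed.

(** Hilbert's basis theorem, for chains: let [L d m] be the ideal of coefficients
    of degree [d] of the elements of [V m] of degree at most [d].  It increases
    with both [d] and [m]; the diagonal [L m m] and the finitely many rows below
    its stable index become constant, and from then on a polynomial of a later
    ideal has its leading coefficients matched, degree after degree. *)
Lemma noetherian_poly (R : comNzRingType) : noetherian R -> noetherian {poly R}.
Proof.
move=> nR V Vid VS.
have Vmono := chain_mono VS.
pose L d m : set R := fun a => exists f, [/\ V m f, (size f <= d.+1)%N & f`_d = a].
have Lid d m : left_ideal (L d m).
  have [V0 VD VM] := Vid m; split.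
  - by exists 0; rewrite size_poly0 coef0.
  - move=> _ _ [f [Vf sf <-]] [g [Vg sg <-]]; exists (f + g).
    rewrite coefD; split=> //; first exact: VD.
    by rewrite (leq_trans (size_polyD _ _)) // geq_max sf.
  - move=> a _ [f [Vf sf <-]]; exists (a%:P * f); rewrite coefCM; split=> //.
      exact: VM.
    by rewrite mul_polyC (leq_trans (size_scale_leq _ _)).
have Lm d : forall i j x, (i <= j)%N -> L d i x -> L d j x.
  by move=> i j x ij [f [Vf sf fE]]; exists f; split=> //; apply: Vmono Vf.
have Ld m : forall i j x, (i <= j)%N -> L i m x -> L j m x.
  apply: (@chain_mono _ (fun i => L i m)) => i _ [f [Vf sf <-]].
  exists ('X * f); have [_ _ VM] := Vid m; split; first exact: VM.
    have [-> |f0] := eqVneq f 0; first by rewrite mulr0 size_poly0.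
    by rewrite mulrC size_mulX.
  by rewrite coefXM.
have [M MP] := nR (fun m => L m m) (fun m => Lid m m)
  (fun m x Lx => Lm _ _ _ _ (leqnSn m) (Ld _ _ _ _ (leqnSn m) Lx)).
have /choice[Md MdP] := fun d => nR (L d) (Lid d) (fun m x => @Lm d _ _ x (leqnSn m)).
pose M' := maxn M (\max_(d < M) Md d).
(* Every row [L d] is constant from [M'] on: rows below [M] by the choice of [Md],
   the others because they lie between two terms of the stable diagonal. *)
have LM' d m x : L d m x -> L d M' x.
  move=> Lx; have [dM|Md_] := ltnP d M.
    apply: Lm (MdP _ _ _ Lx).
    by rewrite leq_max (leq_bigmax (Ordinal dM)) orbT.
  apply: (Lm _ M); rewrite ?leq_maxl //; apply: (Ld _ M) => //.
  apply: (MP (maxn d m)); apply: Ld (leq_maxl _ _) _.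
  exact: Lm (leq_maxr _ _) Lx.
exists M' => m f Vf.
have {Vf} : V (maxn m M') f by apply: Vmono Vf; rewrite leq_maxl.
move: (maxn m M') (leq_maxr m M') => {}m mM'.
move: (size f) {-2}f (leqnn (size f)) => n.
elim: n => [|n IH] {}f sf Vf.
  by move: sf; rewrite leqn0 size_poly_eq0 => /eqP ->; case: (Vid M').
have [g [Vg sg gE]] : L n M' f`_n by apply: (LM' n m); exists f.
have [_ VD _] := Vid M'.
rewrite -(subrK g f); apply: VD => //; apply: IH; last first.
  by apply: left_idealB => //; apply: Vmono Vg.
apply/leq_sizeP => j; rewrite leq_eqVlt => /orP[/eqP <-|nj].
  by rewrite coefB gE subrr.
by rewrite coefB !nth_default ?subrr // ?(leq_trans sf) ?(leq_trans sg).
Qed.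

End Noetherian.

(** * Definable sets over an algebraically closed field *)

Section Zariski.
Variable k : closedFieldType.
Implicit Types (e : seq k) (t : GRing.term k) (f : GRing.formula k).

(** An environment [e] lists the values of the variables.  Iterated polynomial
    rings are hidden behind this statement, which is all that the terms of the
    language of rings need. *)
Lemma noetherian_coords n : exists (R : comNzRingType) (ev : seq k -> {rmorphism R -> k}),
  [/\ noetherian R, forall x, exists r, forall e, ev e r = x &
      forall i, (i < n)%N -> exists r, forall e, ev e r = e`_i].
Proof.
elim: n => [|n [R [ev [nR evC evX]]]].
  exists k, (fun _ => idfun); split=> //; first exact: noetherian_field.
  by move=> x; exists x.
exists {poly R}, (fun e => horner_eval e`_n \o map_poly (ev e)); split.
- exact: noetherian_poly.
- move=> x; have [r rE] := evC x; exists r%:P => e /=.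
  by rewrite map_polyC /= /horner_eval hornerC rE.
- move=> i; rewrite ltnS leq_eqVlt => /orP[/eqP -> |/evX[r rE]].
    by exists 'X => e /=; rewrite map_polyX /horner_eval hornerX.
  by exists r%:P => e /=; rewrite map_polyC /= /horner_eval hornerC rE.
Qed.

(** The terms that vanish on [E m] come from an increasing chain of ideals of a
    noetherian ring. *)
Lemma vanishing_chain_stabilises n (E : nat -> seq k -> Prop) :
  (forall m e, E m e -> size e = n) -> (forall m e, E m.+1 e -> E m e) ->
  exists m0, forall m t, (m0 <= m)%N -> GRing.rterm t ->
    (forall e, E m e -> GRing.eval e t = 0) ->
    forall e, E m0 e -> GRing.eval e t = 0.
Proof.
move=> Esz ES; have [R [ev [nR evC evX]]] := noetherian_coords n.
have termP t : GRing.rterm t ->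
    exists r, forall e, size e = n -> ev e r = GRing.eval e t.
  elim: t => //=.
  - move=> i _; have [/evX[r rE]|ni] := ltnP i n; first by exists r.
    by exists 0 => e se; rewrite rmorph0 nth_default ?se.
  - by move=> x _; have [r rE] := evC x; exists r.
  - by move=> j _; exists j%:R => e _; rewrite rmorph_nat.
  - move=> t1 IH1 t2 IH2 /andP[/IH1[r1 r1E] /IH2[r2 r2E]].
    by exists (r1 + r2) => e se; rewrite rmorphD r1E ?r2E.
  - by move=> t1 IH1 /IH1[r1 r1E]; exists (- r1) => e se; rewrite rmorphN r1E.
  - by move=> t1 IH1 j /IH1[r1 r1E]; exists (r1 *+ j) => e se; rewrite rmorphMn r1E.
  - move=> t1 IH1 t2 IH2 /andP[/IH1[r1 r1E] /IH2[r2 r2E]].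
    by exists (r1 * r2) => e se; rewrite rmorphM r1E ?r2E.
  - by move=> t1 IH1 j /IH1[r1 r1E]; exists (r1 ^+ j) => e se; rewrite rmorphXn r1E.
pose V m : set R := fun r => forall e, E m e -> ev e r = 0.
have [||m0 m0P] := nR V.
- move=> m; split.
  + by move=> e _; rewrite rmorph0.
  + by move=> x y Vx Vy e Ee; rewrite rmorphD Vx // Vy // addr0.
  + by move=> a x Vx e Ee; rewrite rmorphM Vx // mulr0.
- by move=> m r Vr e /ES; apply: Vr.
exists m0 => m t _ /termP[r rE] t0 e Ee.
rewrite -rE; last exact: Esz Ee.
by apply: (m0P m) Ee => e' Ee'; rewrite rE ?t0 //; apply: Esz Ee'.
Qed.

(** Inside every nonempty basic open subset [t != 0] of [Z] there is another one
    that lies either in [S] or in its complement.  Constructible sets have this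
    property in any [Z], irreducible or not, so that no decomposition into
    irreducible components is involved. *)
Definition decided_on_open (Z : seq k -> Prop) (S : seq k -> bool) :=
  forall t, GRing.rterm t -> (exists2 e, Z e & GRing.eval e t != 0) ->
  exists t', [/\ GRing.rterm t', (exists2 e, Z e & GRing.eval e t' != 0),
    (forall e, GRing.eval e t' != 0 -> GRing.eval e t != 0) &
    exists b, forall e, Z e -> GRing.eval e t' != 0 -> S e = b].

Lemma decided_on_open2 (op : bool -> bool -> bool) Z S1 S2 :
  decided_on_open Z S1 -> decided_on_open Z S2 ->
  decided_on_open Z (fun e => op (S1 e) (S2 e)).
Proof.
move=> D1 D2 t rt tZ.
have [t1 [rt1 t1Z t1t [b1 b1E]]] := D1 t rt tZ.
have [t2 [rt2 t2Z t2t [b2 b2E]]] := D2 t1 rt1 t1Z.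
exists t2; split=> //; first by move=> e /t2t/t1t.
by exists (op b1 b2) => e Ze et2; rewrite b2E // b1E //; apply: t2t.
Qed.

(** For an equation [t1 = t2], either it holds on the whole piece, or the piece
    can be cut down to [t1 - t2 != 0]; shrinking twice handles the connectives. *)
Lemma qf_decided_on_open Z f :
  GRing.qf_form f -> GRing.rformula f -> decided_on_open Z (fun e => GRing.qf_eval e f).
Proof.
elim: f => //=.
- by move=> b _ _ t rt tZ; exists t; split=> //; exists b.
- move=> t1 t2 _ /andP[rt1 rt2] t rt tZ.
  have [[e [Ze et e12]]|none] := pselect (exists e, [/\ Z e, GRing.eval e t != 0 &
     GRing.eval e t1 != GRing.eval e t2]).
    exists (GRing.Mul t (GRing.Add t1 (GRing.Opp t2))); split=> /=.
    + by rewrite rt rt1 rt2.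
    + by exists e => //; rewrite mulf_neq0 // subr_eq0.
    + by move=> e'; rewrite mulf_eq0 negb_or => /andP[].
    + exists false => e' _; rewrite mulf_eq0 negb_or subr_eq0 => /andP[_].
      exact: negPf.
  exists t; split=> //; exists true => e Ze et; apply/negPn/negP => ne.
  by apply: none; exists e.
- move=> f1 IH1 f2 IH2 /andP[q1 q2] /andP[r1 r2].
  by apply: (decided_on_open2 andb); [apply: IH1 | apply: IH2].
- move=> f1 IH1 f2 IH2 /andP[q1 q2] /andP[r1 r2].
  by apply: (decided_on_open2 orb); [apply: IH1 | apply: IH2].
- move=> f1 IH1 f2 IH2 /andP[q1 q2] /andP[r1 r2].
  by apply: (decided_on_open2 implb); [apply: IH1 | apply: IH2].
- move=> f1 IH1 q1 r1 t rt tZ; have [t' [? ? ? [b bE]]] := IH1 q1 r1 t rt tZ.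
  by exists t'; split=> //; exists (~~ b) => e Ze et'; rewrite bE.
Qed.

Lemma quantifier_elimination f : exists2 g,
  GRing.qf_form g && GRing.rformula g &
  forall e, GRing.holds e f <-> GRing.qf_eval e g.
Proof.
have wf := @ClosedFieldQE.wf_ex_elim k.
have ok := ClosedFieldQE.holds_ex_elim (@solve_monicpoly k).
exists (GRing.quantifier_elim (@ClosedFieldQE.ex_elim k) (GRing.to_rform f)).
  by apply: GRing.quantifier_elim_wf => //; apply: GRing.to_rform_rformula.
by move=> e; split=> /(GRing.proj_satP wf ok).
Qed.

(** Having the same vanishing terms, [C] and [C'] are both dense in [C \/ C'].  On
    some nonempty open piece of it the formula for [C] is constant; this constant
    must be true because [C] meets the piece, and [C'] meets the piece too. *)
Lemma dense_definable_meet (f : GRing.formula k) (C C' : seq k -> Prop) :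
  (forall e, C e \/ C' e -> GRing.holds e f <-> C e) ->
  (exists e, C e) ->
  (forall t, GRing.rterm t -> (forall e, C e -> GRing.eval e t = 0) <->
     (forall e, C' e -> GRing.eval e t = 0)) ->
  exists2 e, C e & C' e.
Proof.
move=> fC [e0 Ce0] CC'.
have [g /andP[qg rg] gP] := quantifier_elimination f.
have gC e : C e \/ C' e -> reflect (C e) (GRing.qf_eval e g).
  by move=> /fC[fe ef]; apply: (iffP idP) => [/gP/fe|/ef/gP].
have wit (X : seq k -> Prop) t : ~ (forall e, X e -> GRing.eval e t = 0) ->
    exists2 e, X e & GRing.eval e t != 0.
  move=> nX; apply: contrapT => nt; apply: nX => e Xe.
  by apply/eqP/negPn/negP => te; apply: nt; exists e.
have [||t [rt [e Ze et] _ [b bE]]] :=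
    @qf_decided_on_open (fun e => C e \/ C' e) g qg rg (GRing.Const 1).
- by [].
- by exists e0; [left | rewrite /= oner_neq0].
have [e1 Ce1 te1] : exists2 e, C e & GRing.eval e t != 0.
  case: Ze => [Ce|C'e]; first by exists e.
  by apply: wit => /(CC' t rt)/(_ e C'e)/eqP; apply/negP.
have [e2 Ce2 te2] : exists2 e, C' e & GRing.eval e t != 0.
  by apply: wit => /(CC' t rt)/(_ e1 Ce1)/eqP; apply/negP.
exists e2 => //; apply/(gC e2); first by right.
rewrite (bE e2) //; last by right.
by rewrite -(bE e1) //; [apply/(gC e1) => //| ]; left.
Qed.

End Zariski.

Section Definable.
Variable k : closedFieldType.
Implicit Types (e : seq k).

Definition mxenv d (M : 'M[k]_d) : seq k :=
  [seq mxvec M 0 l | l <- enum 'I_(d * d)].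

(** The matrix stored in the [d * d] variables from number [o] on.  The free offset
    keeps the variables of several matrices apart. *)
Definition mxat d (o : nat) e : 'M[k]_d := vec_mx (\row_l e`_(o + l)).

Lemma size_mxenv d (M : 'M_d) : size (mxenv M) = (d * d)%N.
Proof. by rewrite size_map size_enum_ord. Qed.

Lemma nth_mxenv d (M : 'M_d) (l : 'I_(d * d)) : (mxenv M)`_l = mxvec M 0 l.
Proof. by rewrite (nth_map l) ?size_enum_ord // nth_ord_enum. Qed.

Lemma mxatE d o e i j : mxat d o e i j = e`_(o + mxvec_index i j).
Proof. by rewrite mxE mxE. Qed.

Lemma mxat_mxenv d (M : 'M_d) : mxat d 0 (mxenv M) = M.
Proof. by apply/matrixP => i j; rewrite mxatE add0n nth_mxenv mxvecE. Qed.

Definition termfun (F : seq k -> k) :=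
  exists2 t : GRing.term k, GRing.rterm t & forall e, GRing.eval e t = F e.

Lemma termfun_const x : termfun (fun=> x).
Proof. by exists (GRing.Const x). Qed.

Lemma termfun_nth i : termfun (fun e => e`_i).
Proof. by exists (GRing.Var _ i). Qed.

Lemma termfunM F G : termfun F -> termfun G -> termfun (fun e => F e * G e).
Proof.
move=> [t rt tE] [u ru uE]; exists (GRing.Mul t u) => [|e] /=; first by rewrite rt.
by rewrite tE uE.
Qed.

Lemma termfun_sum (T : Type) (r : seq T) (F : T -> seq k -> k) :
  (forall i, termfun (F i)) -> termfun (fun e => \sum_(i <- r) F i e).
Proof.
move=> FT; elim: r => [|i r [t rt tE]].
  by exists (GRing.Const 0) => // e; rewrite big_nil.
have [u ru uE] := FT i.
exists (GRing.Add u t) => [|e] /=; first by rewrite rt ru.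
by rewrite big_cons tE uE.
Qed.

Definition termmx m n (A : seq k -> 'M[k]_(m, n)) :=
  forall i j, termfun (fun e => A e i j).

Lemma termmx_const m n (A : 'M[k]_(m, n)) : termmx (fun=> A).
Proof. by move=> i j; apply: termfun_const. Qed.

Lemma termmx_at d o : termmx (mxat d o).
Proof.
move=> i j; have [t rt tE] := termfun_nth (o + mxvec_index i j).
by exists t => // e; rewrite mxatE.
Qed.

Lemma termmxM m n q (A : seq k -> 'M[k]_(m, n)) (B : seq k -> 'M[k]_(n, q)) :
  termmx A -> termmx B -> termmx (fun e => A e *m B e).
Proof.
move=> At Bt i j.
have [t rt tE] : termfun (fun e => \sum_l A e i l * B e l j).
  by apply: termfun_sum => l; apply: termfunM.
by exists t => // e; rewrite mxE.
Qed.

Lemma termmx_lincomb d n (v : seq k -> 'rV[k]_n) (L : 'I_n -> 'M[k]_d) :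
  termmx v -> termmx (fun e => \sum_j v e 0 j *: L j).
Proof.
move=> vt i j; have [t rt tE] : termfun (fun e => \sum_l v e 0 l * L l i j).
  by apply: termfun_sum => l; apply: termfunM; [apply: vt | apply: termfun_const].
by exists t => // e; rewrite tE summxE; apply: eq_bigr => l _; rewrite mxE.
Qed.

(** Left multiplication by a fixed matrix is a polynomial change of variables. *)
Lemma term_comp_mulmx d (T : 'M[k]_d) (t : GRing.term k) : GRing.rterm t ->
  exists2 t', GRing.rterm t' &
    forall M : 'M_d, GRing.eval (mxenv M) t' = GRing.eval (mxenv (T *m M)) t.
Proof.
elim: t => //=.
- move=> i _; have [id|ni] := ltnP i (d * d); last first.
    by exists (GRing.Const 0) => // M /=; rewrite nth_default ?size_mxenv.
  have [a [b abE]] : exists a b : 'I_d, i = mxvec_index a b :> nat.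
    by rewrite -[i]/(val (Ordinal id)); case/mxvec_indexP: (Ordinal id) => a b; exists a, b.
  have [t rt tE] := termmxM (termmx_const T) (@termmx_at d 0) a b.
  exists t => // M; rewrite tE mxat_mxenv /=.
  by rewrite abE nth_mxenv mxvecE.
- by move=> x _; exists (GRing.Const x).
- by move=> n _; exists (GRing.NatConst _ n).
- move=> t1 IH1 t2 IH2 /andP[/IH1[u1 r1 E1] /IH2[u2 r2 E2]].
  by exists (GRing.Add u1 u2) => [|M]; rewrite /= ?r1 // E1 E2.
- by move=> t1 IH1 /IH1[u1 r1 E1]; exists (GRing.Opp u1) => // M /=; rewrite E1.
- by move=> t1 IH1 n /IH1[u1 r1 E1]; exists (GRing.NatMul u1 n) => // M /=; rewrite E1.
- move=> t1 IH1 t2 IH2 /andP[/IH1[u1 r1 E1] /IH2[u2 r2 E2]].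
  by exists (GRing.Mul u1 u2) => [|M]; rewrite /= ?r1 // E1 E2.
- by move=> t1 IH1 n /IH1[u1 r1 E1]; exists (GRing.Exp u1 n) => // M /=; rewrite E1.
Qed.

(** Formulas may contain quantifiers here: they are eliminated in
    [dense_definable_meet]. *)
Definition formdef (S : seq k -> Prop) :=
  exists f : GRing.formula k, forall e, GRing.holds e f <-> S e.

Lemma formdef_ext S S' : (forall e, S e <-> S' e) -> formdef S -> formdef S'.
Proof. by move=> SS' [f fS]; exists f => e; rewrite fS. Qed.

Lemma formdefI S S' : formdef S -> formdef S' -> formdef (fun e => S e /\ S' e).
Proof. by move=> [f fS] [g gS]; exists (GRing.And f g) => e /=; rewrite fS gS. Qed.

Lemma formdef_forall (T : finType) (S : T -> seq k -> Prop) :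
  (forall i, formdef (S i)) -> formdef (fun e => forall i, S i e).
Proof.
move=> SD; suff [f fS] : formdef (fun e => forall i, i \in enum T -> S i e).
  by exists f => e; rewrite fS; split=> H i; [apply: H; rewrite mem_enum | ].
elim: (enum T) => [|j r IH]; first by exists (GRing.Bool true).
apply: formdef_ext (formdefI (SD j) IH) => e; split.
  by move=> [Sj Sr] i; rewrite inE => /orP[/eqP ->|/Sr].
by move=> H; split=> [|i ir]; apply: H; rewrite inE ?eqxx ?ir ?orbT.
Qed.

Lemma formdef_eqmx m n (A B : seq k -> 'M[k]_(m, n)) :
  termmx A -> termmx B -> formdef (fun e => A e = B e).
Proof.
move=> At Bt; have [|f fE] := @formdef_forall ('I_m * 'I_n)%type
    (fun ij e => A e ij.1 ij.2 = B e ij.1 ij.2).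
  move=> [i j] /=; have [t _ tE] := At i j; have [u _ uE] := Bt i j.
  by exists (GRing.Equal t u) => e /=; rewrite tE uE.
exists f => e; rewrite fE; split=> [H|-> //].
by apply/matrixP => i j; apply: (H (i, j)).
Qed.

Definition definable d (S : 'M[k]_d -> Prop) := forall o, formdef (fun e => S (mxat d o e)).

Lemma definable_exists d d' (S : 'M[k]_d -> 'M[k]_d' -> Prop) :
  (forall o o', formdef (fun e => S (mxat d o e) (mxat d' o' e))) ->
  definable (fun h => exists g, S h g).
Proof.
move=> SD o; pose o' := (o + d * d)%N.
have [f fS] := SD o o'; exists (foldr GRing.Exists f (iota o' (d' * d'))) => e.
have mxat_off e' : {in [predC iota o' (d' * d')], GRing.same_env e e'} ->
    mxat d o e' = mxat d o e.
  move=> ee'; apply/matrixP => i j; rewrite !mxatE -ee' //.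
  by rewrite inE mem_iota negb_and -ltnNge /o' ltn_add2l ltn_ord.
rewrite -GRing.foldExistsP; split.
  by move=> [e' /mxat_off ee' /fS]; rewrite ee'; exists (mxat d' o' e').
move=> [g Sg].
pose e' := mkseq (fun i => if i \in iota o' (d' * d') then (mxenv g)`_(i - o') else e`_i)
  (maxn (size e) (o' + d' * d')).
have e'E i : e'`_i = if i \in iota o' (d' * d') then (mxenv g)`_(i - o') else e`_i.
  have [ilt|ige] := ltnP i (maxn (size e) (o' + d' * d')); first by rewrite nth_mkseq.
  rewrite nth_default ?size_mkseq //; move: ige; rewrite geq_max => /andP[ei oi].
  by rewrite mem_iota ltnNge oi andbF nth_default.
have ee' : {in [predC iota o' (d' * d')], GRing.same_env e e'}.
  by move=> i; rewrite inE e'E => /negPf ->.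
exists e' => //; apply/fS; rewrite mxat_off //.
suff -> : mxat d' o' e' = g by [].
apply/matrixP => i j; rewrite mxatE e'E mem_iota leq_addr ltn_add2l ltn_ord.
by rewrite addKn nth_mxenv mxvecE.
Qed.

(** * Towers of definable groups *)

(** Closure under [w z^-1 y] says that [E m] is a coset of a group of matrices.
    The vanishing terms of the [E m] are the same from some [m0] on.  For [h] in
    [E m0] and [y] in [E m], the translation by [h y^-1] preserves [E m0], hence
    the translate of [E m] still has the same vanishing terms as [E m], and
    meets it: [w = h y^-1 z] with [w] and [z] in [E m].  So [h = w z^-1 y] is in
    [E m]. *)
Lemma coset_chain_stabilises d (E : nat -> 'M[k]_d -> Prop) :
  (forall m, definable (E m)) -> (forall m, exists x, E m x) ->
  (forall m x, E m x -> x \in unitmx) ->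
  (forall m w z y, E m w -> E m z -> E m y -> E m (w *m invmx z *m y)) ->
  (forall m x, E m.+1 x -> E m x) ->
  exists m0, forall m x, E m0 x -> E m x.
Proof.
move=> Edef Ene Eunit Eheap ES.
pose E' m e := exists2 x, E m x & e = mxenv x.
have [||m0 m0P] := @vanishing_chain_stabilises _ (d * d) E'.
- by move=> m _ [x _ ->]; apply: size_mxenv.
- by move=> m _ [x /ES Ex ->]; exists x.
exists m0 => m h Eh; have Emono := chain_anti ES.
have [/Emono|/ltnW m0m] := leqP m m0; first exact.
have [y Ey] := Ene m; have Ey0 := Emono _ _ _ m0m Ey.
have uy := Eunit _ _ Ey; have uh := Eunit _ _ Eh.
pose T := h *m invmx y.
have [f fE] := Edef m 0%N.
have [|||_ [w Ew ->] [z Ez wz]] := @dense_definable_meet _ f (E' m)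
    (fun e => exists2 z, E m z & e = mxenv (T *m z)).
- have H (x : 'M_d) : GRing.holds (mxenv x) f <-> E' m (mxenv x).
    rewrite fE mxat_mxenv; split=> [Ex|[y' Ey' /(congr1 (mxat d 0))]]; first by exists x.
    by rewrite !mxat_mxenv => ->.
  by move=> e [] [x _ ->].
- by exists (mxenv y), y.
- move=> t rt; split=> [tC _ [z Ez ->]|tC' _ [x Ex ->]].
    apply: (m0P m t m0m rt tC); exists (T *m z) => //.
    by apply: Eheap => //; apply: Emono Ez.
  have [t' rt' t'E] := term_comp_mulmx T rt.
  have <- : T *m (y *m invmx h *m x) = x.
    by rewrite /T -!mulmxA mulKmx // mulKVmx.
  rewrite -t'E; apply: (m0P m t' m0m rt').
    by move=> _ [z Ez ->]; rewrite t'E; apply: tC'; exists z.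
  exists (y *m invmx h *m x) => //; apply: Eheap => //.
  exact: Emono Ex.
have {wz} -> : h = w *m invmx z *m y.
  have uz := Eunit _ _ Ez.
  rewrite -[w]mxat_mxenv wz mxat_mxenv /T -!mulmxA [z *m _]mulKVmx //.
  by rewrite mulVmx // mulmx1.
exact: Eheap.
Qed.

(** The vanishing of the first derived limit of a tower of definable groups, where
    [g] lies over [h] when [g p = p h].  Let [E m s] be the set of the candidates
    for [b s] that can be extended to compatible values up to level [s + m].  It
    is a nonempty coset, definable because extending is an existential
    quantification over matrices, and it decreases with [m]; so it is constant
    for large [m].  Then every element of the stable set at level [s] lifts to
    the stable set at level [s.+1], and [b] is built by recursion. *)
Lemma group_tower_twist (d : nat -> nat) (G : forall s, 'M[k]_(d s) -> Prop)
    (p : forall s, 'M[k]_(d s.+1, d s)) (a : forall s, 'M[k]_(d s)) :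
  (forall s, definable (@G s)) ->
  (forall s x, @G s x -> x \in unitmx) ->
  (forall s x y, @G s x -> @G s y -> @G s (x *m y)) ->
  (forall s x, @G s x -> @G s (invmx x)) ->
  (forall s g, @G s.+1 g -> exists2 h, @G s h & g *m p s = p s *m h) ->
  (forall s, @G s (a s)) ->
  exists b : forall s, 'M[k]_(d s),
    (forall s, @G s (b s)) /\ forall s, b s.+1 *m p s = p s *m a s *m b s.
Proof.
move=> Gdef Gunit Gmul Ginv Glift Ga.
pose fix E m s {struct m} : 'M[k]_(d s) -> Prop :=
  if m is m'.+1 then
    fun h => @G s h /\ exists g, E m' s.+1 g /\ g *m p s = p s *m a s *m h
  else @G s.
have EG m s x : E m s x -> @G s x by case: m => //= m [].
have Edef m s : definable (E m s).
  elim: m s => [|m IH] s; first exact: Gdef.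
  move=> o /=; apply: formdefI; first exact: Gdef.
  pose S (h : 'M_(d s)) g := E m s.+1 g /\ g *m p s = p s *m a s *m h.
  apply: (@definable_exists _ _ S _ o) => {}o o'; apply: formdefI; first exact: IH.
  apply: formdef_eqmx; apply: termmxM; try exact: termmx_at; exact: termmx_const.
have Ene m s : exists x, E m s x.
  elim: m s => [|m IH] s /=; first by exists (a s).
  have [g Eg] := IH s.+1; have [h Gh gh] := Glift s g (EG _ _ _ Eg).
  exists (invmx (a s) *m h); split; first by apply/Gmul/Gh/Ginv/Ga.
  by exists g; split=> //; rewrite mulmxA mulmxK // (Gunit _ _ (Ga s)).
have Eheap m s w z y : E m s w -> E m s z -> E m s y -> E m s (w *m invmx z *m y).
  elim: m s w z y => [|m IH] s w z y /=.
    by move=> Gw Gz Gy; apply/Gmul/Gy/Gmul/Ginv/Gz.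
  move=> [Gw [g1 [E1 e1]]] [Gz [g2 [E2 e2]]] [Gy [g3 [E3 e3]]].
  split; first by apply/Gmul/Gy/Gmul/Ginv/Gz.
  exists (g1 *m invmx g2 *m g3); split; first exact: IH.
  have u2 := Gunit _ _ (EG _ _ _ E2); have uz := Gunit _ _ Gz.
  have {}e2 : invmx g2 *m (p s *m a s) = p s *m invmx z.
    by rewrite -[RHS](mulKmx u2) [g2 *m _]mulmxA e2 mulmxK.
  by rewrite -mulmxA e3 [LHS]mulmxA -[g1 *m _ *m _]mulmxA e2 mulmxA e1 !mulmxA.
have ES m s x : E m.+1 s x -> E m s x.
  elim: m s x => [|m IH] s x /=; first by case.
  by move=> [Gx [g [Eg gE]]]; split=> //; exists g; split=> //; apply: IH.
have H s := coset_chain_stabilises (fun m => Edef m s) (fun m => Ene m s)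
  (fun m x Ex => Gunit _ _ (EG m s x Ex)) (fun m => Eheap m s) (fun m => ES m s).
have next s (h : 'M[k]_(d s)) : {g : 'M[k]_(d s.+1) | (forall m, E m s h) ->
    (forall m, E m s.+1 g) /\ g *m p s = p s *m a s *m h}.
  apply: cid; have [Eh|nEh] := pselect (forall m, E m s h); last by exists 0.
  have [m mP] := H s.+1; have [_ [g [Eg gE]]] := Eh m.+1.
  by exists g => _; split=> // m'; apply: mP.
have [m mP] := H 0%N; have [h0 Eh0] := Ene m 0%N.
pose b := nat_rect (fun s => 'M[k]_(d s)) h0 (fun s h => sval (next s h)).
have bE s : forall m, E m s (b s).
  by elim: s => [|s IH] m' /=; [apply: mP | case: (svalP (next s (b s)) IH)].
exists b; split=> s; first exact: (bE s 0%N).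
by case: (svalP (next s (b s)) (bE s)).
Qed.

End Definable.

(** * The filtration of the completed path algebra by path length *)

Section PathFiltration.
Variables (k : fieldType) (Q : quiver).
Notation P := (pathalg k Q).
Implicit Types (a b x y : P) (v : vertex Q) (w : seq (arrow Q)).

Lemma wcoef_add a b v w : wcoef (a + b) v w = wcoef a v w + wcoef b v w.
Proof. exact: wcoefD. Qed.

Lemma wcoef_mul a b v w : wcoef (a * b) v w =
  \sum_(0 <= i < (size w).+1)
     wcoef a v (take i w) * wcoef b (walk_end v (take i w)) (drop i w).
Proof. exact: wcoefM. Qed.

Lemma wcoef_scale c a v w : wcoef (c *: a) v w = c * wcoef a v w.
Proof. exact: wcoefZ. Qed.

Lemma wcoef_one v w : wcoef (1 : P) v w = (size w == 0)%N%:R.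
Proof. exact: wcoef1. Qed.

Lemma wcoef_zero v w : wcoef (0 : P) v w = 0.
Proof. by rewrite -(scale0r (0 : P)) wcoef_scale mul0r. Qed.

Lemma wcoef_opp a v w : wcoef (- a) v w = - wcoef a v w.
Proof. by rewrite -scaleN1r wcoef_scale mulN1r. Qed.

Lemma wcoef_sum (T : Type) (r : seq T) (F : T -> P) v w :
  wcoef (\sum_(i <- r) F i) v w = \sum_(i <- r) wcoef (F i) v w.
Proof.
by apply: (big_morph (fun a => wcoef a v w)) => [a b|];
  [apply: wcoef_add | apply: wcoef_zero].
Qed.

Lemma wcoef_mul0 a b v : wcoef (a * b) v [::] = wcoef a v [::] * wcoef b v [::].
Proof. by rewrite wcoef_mul big_nat1. Qed.

(** The coefficients prescribed by [c] outside the walks of the quiver are ignored. *)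
Definition of_wcoef (c : vertex Q -> seq (arrow Q) -> k) : P :=
  fun n => [ffun p => c (path_source p) (path_arrows p)].

Lemma wcoef_of_wcoef c v w : wcoef (of_wcoef c) v w = if is_walk v w then c v w else 0.
Proof.
case: ifPn => [vw|]; last exact: wcoef_out.
by rewrite (wcoef_in _ vw) ffunE.
Qed.

(** For positive [s] this is the power [J^s] of the radical; the inclusion of the
    radical in [Fil 1] is [jacobson_radical_Fil]. *)
Definition Fil (s : nat) : set P := fun a => forall n, (n < s)%N -> a n = 0.

Lemma FilP s a : Fil s a <-> forall v w, (size w < s)%N -> wcoef a v w = 0.
Proof.
split=> [Fa v w ws|Fa n ns].
  have [vw|] := boolP (is_walk v w); last exact: wcoef_out.
  by rewrite (wcoef_in _ vw) Fa // ffunE.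
by apply/ffunP => p; rewrite wcoefE Fa ?ffunE // size_tuple.
Qed.

Lemma Fil0 s : Fil s 0.
Proof. by []. Qed.

Lemma FilD s a b : Fil s a -> Fil s b -> Fil s (a + b).
Proof.
by move=> /FilP Fa /FilP Fb; apply/FilP => v w ws; rewrite wcoef_add Fa ?Fb ?addr0.
Qed.

Lemma FilM i j a b : Fil i a -> Fil j b -> Fil (i + j) (a * b).
Proof.
move=> /FilP Fa /FilP Fb; apply/FilP => v w ws; rewrite wcoef_mul.
rewrite big_nat big1 // => m /andP[_]; rewrite ltnS => mw.
have [mi|im] := ltnP m i; first by rewrite Fa ?mul0r // size_takel.
rewrite Fb ?mulr0 // size_drop ltn_subLR //.
by rewrite (leq_trans ws) // leq_add2r.
Qed.

Lemma FilW s t a : (s <= t)%N -> Fil t a -> Fil s a.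
Proof. by move=> st Fa n ns; apply: Fa; apply: leq_trans st. Qed.

Lemma Fil_zero a : Fil 0 a.
Proof. by []. Qed.

Lemma FilMl s a b : Fil s b -> Fil s (a * b).
Proof. by apply: FilM (@Fil_zero a). Qed.

Lemma FilMr s a b : Fil s a -> Fil s (a * b).
Proof. by move=> Fa; rewrite -[s]addn0; apply: FilM. Qed.

Lemma FilN s a : Fil s a -> Fil s (- a).
Proof. by rewrite -mulN1r; apply: FilMl. Qed.

Lemma FilB s a b : Fil s a -> Fil s b -> Fil s (a - b).
Proof. by move=> Fa Fb; apply/FilD/FilN. Qed.

Lemma Fil_sum s (T : Type) (r : seq T) (F : T -> P) :
  (forall i, Fil s (F i)) -> Fil s (\sum_(i <- r) F i).
Proof. by move=> FF; apply: big_ind => //; apply: FilD. Qed.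

Lemma Fil_separated a : (forall s, Fil s a) -> a = 0.
Proof. by move=> Fa; apply: functional_extensionality_dep => n; apply: (Fa n.+1). Qed.

Lemma Fil_complete (x : nat -> P) :
  (forall s, Fil s (x s.+1 - x s)) -> exists y, forall s, Fil s (y - x s).
Proof.
move=> Fx.
(* The coefficients in degree [n] no longer change from [x n.+1] on. *)
exists (fun n => x n.+1 n) => s n ns.
have /subnK <- := ns; elim: (s - n.+1)%N => [|i IH]; first exact: subrr.
have := Fx (i + n.+1)%N n (leq_addl _ _).
rewrite -[(i.+1 + _)%N]/((i + n.+1).+1).
move: IH; set z := x _ : P; set z' := x _ : P.
rewrite -[(_ - z) n]/(x n.+1 n - z n) -[(_ - z') n]/(x n.+1 n - z' n).
rewrite -[(_ - z) n]/(z' n - z n).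
by move=> /subr0_eq -> /subr0_eq ->; rewrite subrr.
Qed.

(** The geometric series converges for the filtration. *)
Lemma oneB_right_inverse x : Fil 1 x -> exists y, (1 - x) * y = 1.
Proof.
move=> Fx.
have Fxn n : Fil n (x ^+ n).
  elim: n => [|n IH]; first exact: Fil_zero.
  by rewrite exprS -add1n; apply: FilM.
have [|y yP] := @Fil_complete (fun s => \sum_(i < s) x ^+ i).
  by move=> s; rewrite big_ord_recr /= [_ + x ^+ s]addrC addrK.
exists y; apply/subr0_eq/Fil_separated => s.
have -> : (1 - x) * y - 1 = (1 - x) * (y - \sum_(i < s) x ^+ i) - x ^+ s.
  rewrite mulrBr; have -> : (1 - x) * (\sum_(i < s) x ^+ i) = 1 - x ^+ s.
    elim: s {yP} => [|s IH]; first by rewrite big_ord0 mulr0 expr0 subrr.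
    by rewrite big_ord_recr /= mulrDr IH mulrBl mul1r -exprS addrA subrK.
  by rewrite opprB addrA [RHS]addrAC addrK.
by apply: FilB => //; apply: FilMl.
Qed.

(** Split each path after its first arrow: [x e] is the arrow [e], and [y e] collects
    what follows it.  There being finitely many arrows, this shows that [Fil s]
    consists of finite sums of products of [s] elements of [Fil 1]. *)
Lemma Fil_succ_sum s a : Fil s.+1 a -> exists x y : arrow Q -> P,
  [/\ forall e, Fil 1 (x e), forall e, Fil s (y e) & a = \sum_e x e * y e].
Proof.
move=> /FilP Fa.
exists (fun e => of_wcoef (fun v w => (w == [:: e])%:R)).
exists (fun e => of_wcoef (fun v w => (v == target e)%:R * wcoef a (source e) (e :: w))).
split.
- by move=> e; apply/FilP => v [|//] _; rewrite wcoef_of_wcoef.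
- move=> e; apply/FilP => v w ws; rewrite wcoef_of_wcoef; case: ifP => // _.
  by rewrite Fa ?mulr0.
apply: wcoef_inj => v w; rewrite wcoef_sum.
have [vw|nvw] := boolP (is_walk v w); last first.
  rewrite wcoef_out // big1 // => e _; rewrite wcoef_out //.
case: w vw => [|e w] vw.
  rewrite Fa // big1 // => e _.
  by rewrite wcoef_mul0 wcoef_of_wcoef /= mul0r.
rewrite (bigD1 e) //= big1 ?addr0 => [|e' e'e].
  rewrite wcoef_mul big_nat_recl // big_nat_recl //= big_nat big1 ?addr0 => [|i /andP[_ iw]].
    rewrite wcoef_of_wcoef mul0r add0r take0 drop0 !wcoef_of_wcoef /=.
    by move: vw => /= /andP[/eqP <- wE]; rewrite /walk_end /= wE !eqxx !mul1r.
  rewrite wcoef_of_wcoef; case: ifP; rewrite ?mul0r // => _.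
  have -> : (e :: take i.+1 w == [:: e]) = false; last by rewrite mul0r.
  by apply/negP => /eqP[] /(congr1 size); rewrite size_takel.
rewrite wcoef_mul big1 // => i _; rewrite wcoef_of_wcoef; case: ifP; rewrite ?mul0r // => _.
have -> : (take i (e :: w) == [:: e']) = false; last by rewrite mul0r.
case: i => [|i] //=; apply/negP => /eqP[] /esym e'E.
by rewrite e'E eqxx in e'e.
Qed.

(** At each vertex [v], the elements without the trivial path at [v] form a maximal
    left ideal, the kernel of a character with values in [k]. *)
Lemma jacobson_radical_Fil a : jacobson_radical P a -> Fil 1 a.
Proof.
move=> Ja; apply/FilP => v [|//] _.
pose M : set P := fun a => wcoef a v [::] = 0.
suff /Ja : maximal_left_ideal M by [].
split.
- split=> [|x y Mx My|b x Mx]; rewrite /M ?wcoef_zero //.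
    by rewrite wcoef_add Mx My addr0.
  by rewrite wcoef_mul0 Mx mulr0.
- move=> MT; have : M 1 by rewrite MT.
  by rewrite /M wcoef_one; apply/eqP/oner_neq0.
- move=> N Nid MN; have [NM|] := pselect (forall x, N x -> M x).
    by left; apply/seteqP.
  move=> nNM; right; have [x [Nx /eqP Mx]] : exists x, N x /\ ~ M x.
    by apply: contrapT => nx; apply: nNM => x Nx; apply: contrapT => Mx; apply: nx; exists x.
  have [_ ND NMul] := Nid; have N1 : N 1.
    rewrite -(subrK ((wcoef x v [::])^-1 *: x) 1); apply: ND.
      apply: MN; rewrite /M wcoef_add wcoef_opp wcoef_one wcoef_scale.
      by rewrite mulVf ?subrr.
    by rewrite -[x]mul1r pa_scaleAl; apply: NMul.
  by apply/seteqP; split=> // y _; rewrite -[y]mulr1; apply: NMul.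
Qed.

Lemma relation_ideal_Fil (I : ideal P) a : relation_ideal I -> ideal_set I a -> Fil 1 a.
Proof.
move=> [_ IJ] /IJ[n [x [y [Jx Jy ->]]]]; apply: Fil_sum => i.
exact/FilMr/jacobson_radical_Fil.
Qed.

Lemma closed_Fil (X : set P) a : closed X ->
  (forall s, exists2 x, X x & Fil s (x - a)) -> X a.
Proof.
move=> Xcl Xa.
have /choice[x xP] : forall s, exists x, X x /\ Fil s (x - a).
  by move=> s; have [x ? ?] := Xa s; exists x.
have FF : Filter (fmap x eventually) by apply: fmap_filter.
apply: (@closed_cvg _ _ eventually _ x X Xcl _ a).
  by apply: nearW => s; case: (xP s).
apply/cvg_sup => n U [_ [[W oW <-] Wa WU]].
exists n.+1 => // s ns; apply: WU => /=.
have /(_ n ns)/subr0_eq : Fil s (x s - a) by case: (xP s).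
by rewrite /= => ->.
Qed.

End PathFiltration.

(** * Homomorphisms between quotients of the path algebra *)

Section QuotientProjection.
Variables (k : fieldType) (Q : quiver).
Notation P := (pathalg k Q).
Implicit Types (X Y Z : ideal P) (a b x y : P).

(** [ringquot_pi] with values in the type that carries the [k]-module structure. *)
Definition pq_pi Y a : pathquot Y := ringquot_pi Y a.

Lemma pq_piP Y x y : pq_pi Y x = pq_pi Y y <-> ideal_set Y (x - y).
Proof.
by split=> [/(ringquot_piP Y)/mem_idealP|/mem_idealP Yxy] //; apply/ringquot_piP.
Qed.

Lemma pq_pi_zmod Y : zmod_morphism (pq_pi Y).
Proof.
move=> a b; apply: (addIr (pq_pi Y b)); rewrite subrK.
by rewrite -[LHS](ringquot_piD Y) subrK.
Qed.

HB.instance Definition _ Y :=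
  GRing.isZmodMorphism.Build P (pathquot Y) (pq_pi Y) (@pq_pi_zmod Y).

Lemma pq_pi_monoid Y : monoid_morphism (pq_pi Y).
Proof. by split=> [|a b]; [ | rewrite -[LHS](rq_mulE Y)]. Qed.

HB.instance Definition _ Y :=
  GRing.isMonoidMorphism.Build P (pathquot Y) (pq_pi Y) (@pq_pi_monoid Y).

Lemma pq_pi_scalable Y : scalable (pq_pi Y).
Proof. by move=> c a; rewrite -[LHS](pq_scaleE Y). Qed.

HB.instance Definition _ Y :=
  GRing.isScalable.Build k P (pathquot Y) *:%R (pq_pi Y) (@pq_pi_scalable Y).

Lemma pq_pi0 Y x : pq_pi Y x = 0 <-> ideal_set Y x.
Proof. by rewrite -(raddf0 (pq_pi Y)) pq_piP subr0. Qed.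

Lemma pq_reprK Y (u : pathquot Y) : pq_pi Y (repr u) = u.
Proof. exact: ringquot_reprK. Qed.

Lemma ideal_scale Y (c : k) a : ideal_set Y a -> ideal_set Y (c *: a).
Proof. by move=> /pq_pi0 a0; apply/pq_pi0; rewrite linearZ /= a0 scaler0. Qed.

(** [phi] is a set-theoretic lift of an algebra homomorphism from [P / X] to
    [P / Y]; the axioms hold modulo [Y] only.  Keeping all maps on the single type
    [P] avoids dependent types when the ideals vary. *)
Record qhom X Y (phi : P -> P) : Prop := QHom {
  qhomD : forall a b, pq_pi Y (phi (a + b)) = pq_pi Y (phi a) + pq_pi Y (phi b);
  qhomM : forall a b, pq_pi Y (phi (a * b)) = pq_pi Y (phi a) * pq_pi Y (phi b);
  qhom1 : pq_pi Y (phi 1) = 1;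
  qhomZ : forall c a, pq_pi Y (phi (c *: a)) = c *: pq_pi Y (phi a);
  qhom_ker : forall a, ideal_set X a -> pq_pi Y (phi a) = 0 }.

Lemma qhom_pi X Y phi a b : qhom X Y phi ->
  pq_pi X a = pq_pi X b -> pq_pi Y (phi a) = pq_pi Y (phi b).
Proof.
move=> qphi /pq_piP/(qhom_ker qphi) ab0.
by rewrite -[a](subrK b) (qhomD qphi) ab0 add0r.
Qed.

Lemma qhom_sum X Y phi (T : Type) (r : seq T) (F : T -> P) : qhom X Y phi ->
  pq_pi Y (phi (\sum_(i <- r) F i)) = \sum_(i <- r) pq_pi Y (phi (F i)).
Proof.
move=> qphi; apply: (big_morph (fun a => pq_pi Y (phi a))) => [a b|].
  exact: (qhomD qphi).
by apply: (qhom_ker qphi); case: (idealP X) => -[].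
Qed.

Lemma qhom_id X Y : (ideal_set X `<=` ideal_set Y)%classic -> qhom X Y id.
Proof.
move=> XY; split=> //=; first exact: raddfD.
- exact: rmorphM.
- by move=> c a; rewrite linearZ.
- by move=> a /XY/pq_pi0.
Qed.

Lemma qhom_comp X Y Z phi psi : qhom Y Z psi -> qhom X Y phi -> qhom X Z (psi \o phi).
Proof.
move=> qpsi qphi; split=> /=.
- move=> a b; rewrite -(qhomD qpsi); apply: (qhom_pi qpsi).
  by rewrite (qhomD qphi) raddfD.
- move=> a b; rewrite -(qhomM qpsi); apply: (qhom_pi qpsi).
  by rewrite (qhomM qphi) rmorphM.
- by rewrite -(qhom1 qpsi); apply: (qhom_pi qpsi); rewrite (qhom1 qphi) rmorph1.
- move=> c a; rewrite -(qhomZ qpsi); apply: (qhom_pi qpsi).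
  by rewrite (qhomZ qphi) linearZ.
- move=> a Xa; apply: (qhom_ker qpsi); apply/pq_pi0; exact: (qhom_ker qphi).
Qed.

(** Homomorphisms respect the filtration.  In degree one: if [phi x] had a nonzero
    coefficient [c] at some trivial path, then [1 - c^-1 x] would be invertible
    while its image has coefficient zero there.  The higher degrees follow since
    [Fil s] is generated by products of [s] elements of [Fil 1]. *)
Lemma qhom_Fil X Y phi s a : qhom X Y phi -> (ideal_set Y `<=` @Fil k Q 1)%classic ->
  Fil s a -> exists2 b, Fil s b & pq_pi Y (phi a) = pq_pi Y b.
Proof.
move=> qphi YF.
have Fil1 x : Fil 1 x -> Fil 1 (phi x).
  move=> Fx; apply/FilP => v [|//] _; apply/eqP/negPn/negP => c0.
  set c := wcoef _ _ _ in c0.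
  have [|y yE] := @oneB_right_inverse _ _ (c^-1 *: x).
    by move/FilP: Fx => Fx; apply/FilP => v1 w1 ws; rewrite wcoef_scale Fx // mulr0.
  have uE : pq_pi Y (phi (1 - c^-1 *: x)) = pq_pi Y (1 - c^-1 *: phi x).
    rewrite (qhomD qphi) (qhom1 qphi) -scaleN1r !(qhomZ qphi) scaleN1r.
    by rewrite raddfB /= rmorph1 (pq_pi_scalable Y).
  have /pq_piP/YF/FilP/(_ v [::] isT) : pq_pi Y ((1 - c^-1 *: phi x) * phi y) = pq_pi Y 1.
    by rewrite rmorphM /= -uE -(qhomM qphi) yE (qhom1 qphi) rmorph1.
  rewrite wcoef_add wcoef_opp wcoef_mul0 wcoef_add wcoef_opp wcoef_scale wcoef_one.
  by rewrite -/c mulVf // subrr mul0r sub0r => /eqP; rewrite oppr_eq0 oner_eq0.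
elim: s a => [|s IH] a Fa; first by exists (phi a).
have [x [y [Fx Fy ->]]] := Fil_succ_sum Fa.
have /choice[b bP] : forall e, exists b, Fil s b /\ pq_pi Y (phi (y e)) = pq_pi Y b.
  by move=> e; have [b Fb bE] := IH _ (Fy e); exists b.
exists (\sum_e phi (x e) * b e).
  by apply: Fil_sum => e; rewrite -add1n; apply: FilM; [apply: Fil1 | case: (bP e)].
rewrite (qhom_sum _ _ qphi) raddf_sum; apply: eq_bigr => e _.
by rewrite (qhomM qphi) (proj2 (bP e)) /= rmorphM.
Qed.

End QuotientProjection.

(** * Coordinates on finite-dimensional quotients *)

(** Among the square matrices with all their rows in [S], one of maximal rank spans
    [S]. *)
Lemma subspace_rowspan (k : fieldType) n (S : 'rV[k]_n -> Prop) : S 0 ->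
  (forall x y, S x -> S y -> S (x + y)) -> (forall c x, S x -> S (c *: x)) ->
  exists A : 'M_n, forall x, S x <-> (x <= A)%MS.
Proof.
move=> S0 SD SZ.
pose good r := `[< exists A : 'M_n, (forall i, S (row i A)) /\ \rank A = r >].
have ex0 : exists r, good r.
  by exists 0%N; apply/asboolP; exists 0; split=> [i|]; rewrite ?row0 ?mxrank0.
have bound r : good r -> (r <= n)%N.
  by move=> /asboolP[A [_ <-]]; apply: rank_leq_row.
case: (ex_maxnP ex0 bound) => r /asboolP[A [SA rA]] rmax; exists A => x; split.
  move=> Sx; have S' (B : 'M_n) : (B <= col_mx A x)%MS -> forall y : 'rV_n, (y <= B)%MS -> S y.
    move=> BA y yB; have /submxP[D ->] := submx_trans yB BA.
    rewrite -[D]hsubmxK mul_row_col; apply: (SD).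
      by rewrite mulmx_sum_row; apply: big_ind => // i _; apply: (SZ).
    by rewrite [rsubmx D]mx11_scalar mul_scalar_mx; apply: (SZ).
  have : good (\rank (A + x)%MS).
    apply/asboolP; exists (A + x)%MS; split=> // i.
    by apply: (S' (A + x)%MS); rewrite ?row_sub // addsmxE submx_refl.
  move/rmax; rewrite -rA => rAx.
  have := mxrank_leqif_sup (addsmxSl A x); case=> _ /esym.
  rewrite eqn_leq rAx (mxrankS (addsmxSl A x)) => /idP.
  by rewrite addsmx_sub => /andP[].
by move=> /submxP[D ->]; rewrite mulmx_sum_row; apply: big_ind => // i _; apply: (SZ).
Qed.

Section Coordinates.
Variables (k : fieldType) (Q : quiver).
Notation P := (pathalg k Q).
Implicit Types (a b : P).

Definition short_path s : finType := {i : 'I_s & qpath Q i}.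

Definition trunc s a : 'rV[k]_#|short_path s| :=
  \row_j let x : short_path s := enum_val j in a (tag x) (tagged x).

Lemma trunc_linear s : linear (@trunc s).
Proof. by move=> c a b; apply/rowP => j; rewrite !mxE /= !wcoefE wcoef_add wcoef_scale. Qed.

HB.instance Definition _ s :=
  GRing.isLinear.Build k P 'rV[k]_#|short_path s| *:%R (@trunc s) (@trunc_linear s).

Lemma trunc_eq0 s a : trunc s a = 0 <-> Fil s a.
Proof.
split=> [/rowP a0 n ns|Fa].
  apply/ffunP => p; rewrite ffunE.
  pose x : short_path s := Tagged (fun i : 'I_s => qpath Q i) (i := Ordinal ns) p.
  by have := a0 (enum_rank x); rewrite !mxE enum_rankK.
by apply/rowP => j; rewrite !mxE /= Fa ?ffunE.
Qed.

Lemma trunc_surj s y : exists a, trunc s a = y.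
Proof.
pose coef n (p : qpath Q n) : k := if pselect (n < s)%N is left ns then
    y 0 (enum_rank (Tagged (fun i : 'I_s => qpath Q i) (i := Ordinal ns) p : short_path s))
  else 0.
exists ((fun n => finfun (@coef n)) : P).
apply/rowP => j; rewrite mxE -[in RHS](enum_valK j).
case: (enum_val j) => -[n ns] p /=; rewrite ffunE /coef.
case: pselect => [ns'|//].
by rewrite (bool_irrelevance ns' ns).
Qed.

(** The common bound on the dimension, independent of [U], is what makes chains of
    such ideals stabilise. *)
Lemma quotient_coords s (U : ideal P) : (@Fil k Q s `<=` ideal_set U)%classic ->
  exists d (c : {linear P -> 'rV[k]_d}), [/\ (d <= #|short_path s|)%N,
    forall y, exists a, c a = y & forall a, c a = 0 <-> ideal_set U a].
Proof.
move=> FU; have [[U0 UD _] _] := idealP U.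
have [|||A AP] := @subspace_rowspan k _ (fun y => exists2 a, ideal_set U a & trunc s a = y).
- by exists 0 => //; rewrite raddf0.
- by move=> _ _ [a Ua <-] [b Ub <-]; exists (a + b); [apply: UD | rewrite raddfD].
- by move=> x _ [a Ua <-]; exists (x *: a); [apply: ideal_scale | rewrite linearZ].
exists (\rank (cokermx A)), (mulmxr (col_base (cokermx A)) \o @trunc s); split.
- exact: rank_leq_row.
- move=> y; have [a aE] := trunc_surj (y *m pinvmx (col_base (cokermx A))).
  by exists a; rewrite /= aE mulmxKpV // submx_full // col_base_full.
- move=> a /=; have -> : trunc s a *m col_base (cokermx A) = 0 <-> (trunc s a <= A)%MS.
    rewrite submxE; have := mulmx_base (cokermx A); move: (row_base _) (row_base_free (cokermx A)).
    move=> B Bfree BE; rewrite -[X in _ <-> is_true (_ *m X == 0)]BE mulmxA.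
    split=> [->|/eqP]; first by rewrite mul0mx.
    by move/(canRL (mulmxKp Bfree)); rewrite mul0mx.
  rewrite -AP; split=> [[b Ub ab]|Ua]; last by exists a.
  rewrite -(subrK b a); apply: UD => //; apply/FU/trunc_eq0.
  by rewrite raddfB /= ab subrr.
Qed.

End Coordinates.

(** * Automorphisms of the finite-dimensional quotients *)

Section CoordinateAutomorphisms.
Variables (k : fieldType) (Q : quiver).
Notation P := (pathalg k Q).
Implicit Types (a b : P) (U : ideal P).

(** The matrices of the automorphisms of the quotient of [P] by the kernel of [c].
    Lifts [a'], [b'] of the images of [a], [b] express multiplicativity without
    choosing a multiplication on row vectors. *)
Definition coord_aut d (c : P -> 'rV[k]_d) (M : 'M[k]_d) : Prop :=
  [/\ M \in unitmx, c 1 *m M = c 1 &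
    forall a b a' b', c a' = c a *m M -> c b' = c b *m M ->
      c (a' * b') = c (a * b) *m M].

Variables (U : ideal P) (d : nat) (c : {linear P -> 'rV[k]_d}).
Hypothesis c_surj : forall y, exists a, c a = y.
Hypothesis c_ker : forall a, c a = 0 <-> ideal_set U a.

Lemma coordP a b : c a = c b <-> pq_pi U a = pq_pi U b.
Proof.
rewrite pq_piP -c_ker raddfB /=; split=> [-> |/subr0_eq //]; exact: subrr.
Qed.

Lemma coord_autM M N : coord_aut c M -> coord_aut c N -> coord_aut c (M *m N).
Proof.
move=> [uM M1 MM] [uN N1 NM]; split; first by rewrite unitmx_mul uM.
  by rewrite mulmxA M1.
move=> a b a' b'; rewrite !mulmxA.
have [a2 a2E] := c_surj (c a *m M); have [b2 b2E] := c_surj (c b *m M).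
by rewrite -a2E -b2E -(MM _ _ _ _ a2E b2E); apply: NM.
Qed.

Lemma coord_autV M : coord_aut c M -> coord_aut c (invmx M).
Proof.
move=> [uM M1 MM]; split; first by rewrite unitmx_inv.
  by rewrite -{1}M1 mulmxK.
move=> a b a' b' aE bE; rewrite (MM a' b' a b) ?mulmxK //.
  by rewrite aE mulmxKV.
by rewrite bE mulmxKV.
Qed.

Lemma coord_basis : exists e : 'I_d -> P, forall i, c (e i) = delta_mx 0 i.
Proof.
by have /choice[e eE] := fun i : 'I_d => c_surj (delta_mx 0 i); exists e.
Qed.

(** [L i] is the matrix of the left multiplication by the [i]-th basis vector. *)
Lemma structure_matrices : exists L : 'I_d -> 'M[k]_d,
  forall a b, c (a * b) = c b *m \sum_i c a 0 i *: L i.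
Proof.
have [e eE] := coord_basis.
pose sec (y : 'rV[k]_d) : P := \sum_i y 0 i *: e i.
have secK a : pq_pi U (sec (c a)) = pq_pi U a.
  apply/coordP; rewrite raddf_sum [RHS]row_sum_delta; apply: eq_bigr => i _.
  by rewrite /= linearZ /= eE.
exists (fun i => \matrix_j c (e i * e j)) => a b.
have -> : c (a * b) = c (sec (c a) * sec (c b)).
  by apply/coordP; rewrite !rmorphM /= !secK.
rewrite mulr_suml raddf_sum mulmx_sumr; apply: eq_bigr => i _.
rewrite -scalemxAr mulmx_sum_row scaler_sumr mulr_sumr raddf_sum.
apply: eq_bigr => j _ /=; rewrite rowK.
by rewrite -pa_scaleAl -pa_scaleAr linearZ /= linearZ.
Qed.

(** Multiplicativity as finitely many polynomial equations in the entries of [M]. *)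
Lemma coord_autE (L : 'I_d -> 'M[k]_d) M :
  (forall a b, c (a * b) = c b *m \sum_i c a 0 i *: L i) ->
  coord_aut c M <-> [/\ M \in unitmx, c 1 *m M = c 1 &
    forall i, M *m (\sum_j M i j *: L j) = L i *m M].
Proof.
move=> LE; split=> -[uM M1 MM]; split=> //.
  move=> i; apply/row_matrixP => j; rewrite !rowE.
  have [a aE] := c_surj (delta_mx 0 i); have [b bE] := c_surj (delta_mx 0 j).
  have [a' a'E] := c_surj (c a *m M); have [b' b'E] := c_surj (c b *m M).
  have := MM a b a' b' a'E b'E; rewrite !LE b'E a'E aE bE -(rowE i M) -!mulmxA => H.
  have -> : \sum_j M i j *: L j = \sum_j row i M 0 j *: L j.
    by apply: eq_bigr => l _; rewrite mxE.
  rewrite H (bigD1 i) //= big1 ?addr0 => [|l li]; rewrite mxE eqxx.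
    by rewrite eqxx scale1r.
  by rewrite (negPf li) scale0r.
move=> a b a' b' aE bE; rewrite !LE aE bE -!mulmxA; congr (_ *m _).
rewrite mulmx_suml mulmx_sumr.
transitivity (\sum_i c a 0 i *: (M *m \sum_j M i j *: L j)); last first.
  by apply: eq_bigr => i _; rewrite MM -scalemxAl.
under eq_bigr do rewrite mxE scaler_suml mulmx_sumr.
rewrite exchange_big; apply: eq_bigr => i _ /=.
rewrite mulmx_sumr scaler_sumr; apply: eq_bigr => j _.
by rewrite -!scalemxAr scalerA.
Qed.

Lemma coord_aut_qhom M : coord_aut c M ->
  exists2 phi, qhom U U phi & forall a, c (phi a) = c a *m M.
Proof.
move=> [uM M1 MM].
have /choice[phi phiE] := fun a => c_surj (c a *m M).
exists phi => //; split.
- by move=> a b; rewrite -raddfD; apply/coordP; rewrite /= phiE !raddfD /= !phiE mulmxDl.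
- move=> a b; rewrite -rmorphM; apply/coordP; rewrite phiE; symmetry.
  by apply: MM; rewrite phiE.
- by rewrite -(rmorph1 (pq_pi U)); apply/coordP; rewrite phiE M1.
- move=> x a; rewrite -linearZ; apply/coordP; rewrite /= phiE !linearZ /= phiE.
  by rewrite scalemxAl.
- move=> a /c_ker a0; rewrite -(raddf0 (pq_pi U)); apply/coordP.
  by rewrite phiE a0 raddf0 mul0mx.
Qed.

Lemma qhom_coord_aut phi : qhom U U phi ->
  (forall b, exists a, pq_pi U (phi a) = pq_pi U b) ->
  exists2 M, coord_aut c M & forall a, c (phi a) = c a *m M.
Proof.
move=> qphi phi_surj; have [e eE] := coord_basis.
pose M : 'M[k]_d := \matrix_i c (phi (e i)).
have ME a : c (phi a) = c a *m M.
  have -> : c (phi a) = c (\sum_i c a 0 i *: phi (e i)).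
    apply/coordP; rewrite raddf_sum.
    transitivity (pq_pi U (phi (\sum_i c a 0 i *: e i))).
      apply: (qhom_pi qphi); apply/coordP.
      rewrite raddf_sum [LHS]row_sum_delta; apply: eq_bigr => i _.
      by rewrite /= linearZ /= eE.
    rewrite (qhom_sum _ _ qphi); apply: eq_bigr => i _.
    by rewrite (qhomZ qphi) /= linearZ.
  rewrite raddf_sum mulmx_sum_row; apply: eq_bigr => i _.
  by rewrite /= linearZ /= rowK.
exists M => //; split.
- have /choice[X XM] : forall i : 'I_d, exists x : 'rV_d, x *m M = delta_mx 0 i.
    move=> i; have [b bE] := c_surj (delta_mx 0 i).
    have [a aE] := phi_surj b; exists (c a).
    by rewrite -ME -bE; apply/coordP.
  have /mulmx1_unit[] // : (\matrix_i X i) *m M = 1%:M.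
  by apply/row_matrixP => i; rewrite row_mul rowK XM row1.
- by rewrite -ME; apply/coordP; rewrite (qhom1 qphi) rmorph1.
- move=> a b a' b'; rewrite -!ME => /coordP aE /coordP bE; apply/coordP.
  by rewrite (qhomM qphi) rmorphM /= aE bE.
Qed.

Lemma coord_factor (U' : ideal P) d' (c' : {linear P -> 'rV[k]_d'}) :
  (forall a, c' a = 0 <-> ideal_set U' a) -> (ideal_set U `<=` ideal_set U')%classic ->
  exists p : 'M_(d, d'), forall a, c' a = c a *m p.
Proof.
move=> c'_ker UU'; have [e eE] := coord_basis.
have c_c' x y : c x = c y -> c' x = c' y.
  move=> xy; apply/subr0_eq; rewrite -(raddfB c'); apply/c'_ker/UU'/c_ker.
  by rewrite raddfB /= xy subrr.
exists (\matrix_i c' (e i)) => a.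
have -> : c' a = c' (\sum_i c a 0 i *: e i).
  apply: c_c'; rewrite raddf_sum [LHS]row_sum_delta; apply: eq_bigr => i _.
  by rewrite /= linearZ /= eE.
rewrite raddf_sum mulmx_sum_row; apply: eq_bigr => i _.
by rewrite /= linearZ /= rowK.
Qed.

End CoordinateAutomorphisms.

Section Tower.
Variables (k : closedFieldType) (Q : quiver).
Notation P := (pathalg k Q).

Lemma coord_aut_definable U d (c : {linear P -> 'rV[k]_d}) :
  (forall y, exists a, c a = y) -> (forall a, c a = 0 <-> ideal_set U a) ->
  definable (coord_aut c).
Proof.
move=> c_surj c_ker o; have [L LE] := structure_matrices c_surj c_ker.
pose M (e : seq k) := mxat d o e.
pose S e := (exists N : 'M_d, M e *m N = 1%:M) /\ (c 1 *m M e = c 1 /\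
  forall i, M e *m (\sum_j row i (M e) 0 j *: L j) = L i *m M e).
apply: (@formdef_ext _ S) => [e|].
  have rowM i : \sum_j row i (M e) 0 j *: L j = \sum_j M e i j *: L j.
    by apply: eq_bigr => j _; rewrite mxE.
  rewrite (coord_autE c_surj _ LE) -/(M e).
  split=> [[[N /mulmx1_unit[uM _]] [M1 MM]]|[uM M1 MM]].
    by split=> // i; rewrite -MM rowM.
  split; first by exists (invmx (M e)); rewrite mulmxV.
  by split=> // i; rewrite rowM.
rewrite /S; apply: formdefI.
  apply: (@definable_exists _ _ _ (fun (h : 'M_d) N => h *m N = 1%:M)) => o1 o'.
  by apply: formdef_eqmx; [apply: termmxM; apply: termmx_at | apply: termmx_const].
apply: formdefI.
  apply: formdef_eqmx; last exact: termmx_const.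
  by apply: termmxM; [apply: termmx_const | apply: termmx_at].
apply: formdef_forall => i; apply: formdef_eqmx; apply: termmxM.
- exact: termmx_at.
- apply: termmx_lincomb => j l; have [t rt tE] := @termmx_at k d o i l.
  by exists t => // e; rewrite tE [RHS]mxE.
- exact: termmx_const.
- exact: termmx_at.
Qed.

(** Automorphisms of [P / U s.+1] descend to [P / U s] because the kernel of the
    projection is the image of [Fil s], which they preserve by [qhom_Fil].  So
    the automorphism groups form a tower of definable groups, to which
    [group_tower_twist] applies with the twists [tau]. *)
Lemma filtered_tower_twist (U : nat -> ideal P) (tau : nat -> P -> P) :
  (forall s, (@Fil k Q s `<=` ideal_set (U s))%classic) ->
  (forall s, (ideal_set (U s.+1) `<=` ideal_set (U s))%classic) ->
  (forall s a, ideal_set (U s) a -> exists2 b, Fil s b & ideal_set (U s.+1) (a - b)) ->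
  (forall s, (ideal_set (U s.+1) `<=` @Fil k Q 1)%classic) ->
  (forall s, qhom (U s) (U s) (tau s)) ->
  (forall s b, exists a, pq_pi (U s) (tau s a) = pq_pi (U s) b) ->
  exists beta beta' : nat -> P -> P,
    [/\ forall s, qhom (U s) (U s) (beta s), forall s, qhom (U s) (U s) (beta' s),
      forall s a, pq_pi (U s) (beta s (beta' s a)) = pq_pi (U s) a,
      forall s a, pq_pi (U s) (beta' s (beta s a)) = pq_pi (U s) a &
      forall s a, pq_pi (U s) (beta s.+1 a) = pq_pi (U s) (beta s (tau s a))].
Proof.
move=> FU US USF UF qtau tau_surj.
have /choice[dc dcP] : forall s, exists dc : {d : nat & {linear P -> 'rV[k]_d}},
    (forall y, exists a, tagged dc a = y) /\
    (forall a, tagged dc a = 0 <-> ideal_set (U s) a).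
  by move=> s; have [d [c [_ ? ?]]] := quotient_coords (FU s);
  exists (Tagged (fun d => {linear P -> 'rV[k]_d}) c).
pose d s := tag (dc s); pose c s : {linear P -> 'rV[k]_(d s)} := tagged (dc s).
have c_surj s : forall y, exists a, c s a = y by case: (dcP s).
have c_ker s : forall a, c s a = 0 <-> ideal_set (U s) a by case: (dcP s).
have UP s a b : pq_pi (U s.+1) a = pq_pi (U s.+1) b -> pq_pi (U s) a = pq_pi (U s) b.
  by move=> /pq_piP/US/pq_piP.
pose G s := coord_aut (c s).
have p_sig s : {p : 'M[k]_(d s.+1, d s) | forall a, c s a = c s.+1 a *m p}.
  exact/cid/(coord_factor (c_surj s.+1) (c_ker s.+1) (c_ker s) (US s)).
pose p s := sval (p_sig s).
have pE s a : c s a = c s.+1 a *m p s := svalP (p_sig s) a.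
have A_sig s : {A : 'M[k]_(d s) | G s A /\ forall a, c s (tau s a) = c s a *m A}.
  by apply: cid; have [A] := qhom_coord_aut (c_surj s) (c_ker s) (qtau s) (tau_surj s); exists A.
pose A s := sval (A_sig s).
have GA s : G s (A s) := proj1 (svalP (A_sig s)).
have aE s a : c s (tau s a) = c s a *m A s := proj2 (svalP (A_sig s)) a.
have mx_ext s n (B C : 'M[k]_(d s, n)) : (forall a, c s a *m B = c s a *m C) -> B = C.
  move=> BC; apply/row_matrixP => i; rewrite !rowE.
  by have [a <-] := c_surj s (delta_mx 0 i).
have Glift s g : G s.+1 g -> exists2 h, G s h & g *m p s = p s *m h.
  move=> Gg; have [phi qphi phiE] := coord_aut_qhom (c_surj s.+1) (c_ker s.+1) Gg.
  have [psi qpsi psiE] := coord_aut_qhom (c_surj s.+1) (c_ker s.+1)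
    (coord_autV Gg).
  have ug : g \in unitmx by case: Gg.
  have [||h Gh hE] := @qhom_coord_aut _ _ (U s) _ (c s) (c_surj s) (c_ker s) phi.
  - have q := qhom_comp (qhom_id (US s)) qphi; split.
    + exact: (qhomD q).
    + exact: (qhomM q).
    + exact: (qhom1 q).
    + exact: (qhomZ q).
    move=> a /USF[b Fb /pq_piP ab].
    have [b' Fb' b'E] := qhom_Fil qphi (UF s) Fb.
    have -> : pq_pi (U s) (phi a) = pq_pi (U s) b'.
      by apply/UP; rewrite -b'E; apply: (qhom_pi qphi).
    by apply/pq_pi0/FU.
  - move=> b; exists (psi b); apply/UP/(coordP (c_ker s.+1)).
    by rewrite phiE psiE mulmxKV.
  exists h => //; apply: mx_ext => a.
  by rewrite !mulmxA -pE -phiE -pE hE.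
have [b [Gb bE]] := group_tower_twist
  (fun s => coord_aut_definable (c_surj s) (c_ker s)) (fun s M GM => let: And3 uM _ _ := GM in uM)
  (fun s => @coord_autM _ _ _ _ (c_surj s)) (fun s => @coord_autV _ _ _ (c s)) Glift GA.
have /choice[beta betaP] : forall s, exists beta, qhom (U s) (U s) beta /\
    forall a, c s (beta a) = c s a *m b s.
  by move=> s; have [beta] := coord_aut_qhom (c_surj s) (c_ker s) (Gb s); exists beta.
have /choice[beta' beta'P] : forall s, exists beta, qhom (U s) (U s) beta /\
    forall a, c s (beta a) = c s a *m invmx (b s).
  move=> s; have := coord_autV (Gb s).
  by move=> /(coord_aut_qhom (c_surj s) (c_ker s))[beta']; exists beta'.
have ub s : b s \in unitmx by case: (Gb s).
exists beta, beta'; split.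
- by move=> s; case: (betaP s).
- by move=> s; case: (beta'P s).
- move=> s a; apply/(coordP (c_ker s)).
  by rewrite (proj2 (betaP s)) (proj2 (beta'P s)) mulmxKV.
- move=> s a; apply/(coordP (c_ker s)).
  by rewrite (proj2 (beta'P s)) (proj2 (betaP s)) mulmxK.
- move=> s a; apply/(coordP (c_ker s)).
  rewrite pE !(proj2 (betaP _)) aE [c s a]pE -!mulmxA; congr (_ *m _).
  by rewrite bE mulmxA.
Qed.

End Tower.

(** * The ideals X + Fil s *)

Section AddFil.
Variables (k : fieldType) (Q : quiver).
Notation P := (pathalg k Q).
Implicit Types (X Y : ideal P) (a b : P).

Lemma addFil_subproof X s :
  two_sided_ideal (fun a => exists2 x, ideal_set X x & Fil s (a - x)).
Proof.
have [[X0 XD XMl] XMr] := idealP X; split; first split.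
- by exists 0; rewrite ?subrr //; apply: Fil0.
- move=> a b [x Xx ax] [y Xy by_]; exists (x + y); first exact: XD.
  by rewrite opprD addrACA; apply: FilD.
- by move=> a b [x Xx bx]; exists (a * x); [apply: XMl | rewrite -mulrBr; apply: FilMl].
- by move=> a b [x Xx ax]; exists (x * b); [apply: XMr | rewrite -mulrBl; apply: FilMr].
Qed.

Definition addFil X s : ideal P := Ideal (addFil_subproof X s).

Lemma addFil_Fil X s : (@Fil k Q s `<=` ideal_set (addFil X s))%classic.
Proof. by move=> a Fa; exists 0; rewrite ?subr0 //; case: (idealP X) => -[]. Qed.

Lemma addFil_ideal X s : (ideal_set X `<=` ideal_set (addFil X s))%classic.
Proof. by move=> a Xa; exists a => //; rewrite subrr; apply: Fil0. Qed.

Lemma addFilS X Y s t : (ideal_set X `<=` ideal_set Y)%classic -> (t <= s)%N ->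
  (ideal_set (addFil X s) `<=` ideal_set (addFil Y t))%classic.
Proof. by move=> XY ts a [x /XY Yx ax]; exists x => //; apply: FilW ax. Qed.

Lemma addFil_sub1 X s : (ideal_set X `<=` @Fil k Q 1)%classic ->
  (ideal_set (addFil X s.+1) `<=` @Fil k Q 1)%classic.
Proof. by move=> XF a [x /XF Fx ax]; rewrite -(subrK x a); apply: FilD => //; apply: FilW ax. Qed.

Lemma addFil_succ X s a : ideal_set (addFil X s) a ->
  exists2 b, Fil s b & ideal_set (addFil X s.+1) (a - b).
Proof.
by move=> [x Xx ax]; exists (a - x) => //; apply: addFil_ideal; rewrite opprB addrC subrK.
Qed.

Lemma closed_addFil X a : closed (ideal_set X) ->
  (forall s, exists2 t, (s <= t)%N & ideal_set (addFil X t) a) -> ideal_set X a.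
Proof.
move=> Xcl Xa; apply: closed_Fil Xcl _ => s; have [t st [x Xx ax]] := Xa s.
by exists x => //; rewrite -opprB; apply/FilN/(FilW st).
Qed.

Lemma qhom_addFil X Y phi s : qhom X Y phi -> (ideal_set Y `<=` @Fil k Q 1)%classic ->
  qhom (addFil X s) (addFil Y s) phi.
Proof.
move=> qphi YF; have q := qhom_comp (qhom_id (@addFil_ideal Y s)) qphi; split.
- exact: (qhomD q).
- exact: (qhomM q).
- exact: (qhom1 q).
- exact: (qhomZ q).
move=> a [x Xx Fax]; have [b Fb abE] := qhom_Fil qphi YF Fax.
rewrite -[a](subrK x) (qhomD q) (qhom_ker q Xx) addr0.
have -> : pq_pi (addFil Y s) (phi (a - x)) = pq_pi (addFil Y s) b.
  by apply/pq_piP/addFil_ideal/pq_piP.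
by apply/pq_pi0/addFil_Fil.
Qed.

Lemma pq_piS X Y a b : (ideal_set X `<=` ideal_set Y)%classic ->
  pq_pi X a = pq_pi X b -> pq_pi Y a = pq_pi Y b.
Proof. by move=> XY /pq_piP/XY/pq_piP. Qed.

(** Correct each [x s] within its class modulo [V s] so that consecutive terms agree
    modulo [Fil s], then take the limit. *)
Lemma filtered_complete (V : nat -> ideal P) (x : nat -> P) :
  (forall s, (@Fil k Q s `<=` ideal_set (V s))%classic) ->
  (forall s a, ideal_set (V s) a -> exists2 b, Fil s b & ideal_set (V s.+1) (a - b)) ->
  (forall s, pq_pi (V s) (x s.+1) = pq_pi (V s) (x s)) ->
  exists y, forall s, pq_pi (V s) y = pq_pi (V s) (x s).
Proof.
move=> FV VS xE.
have /choice[next nextP] : forall su : nat * P, exists z,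
    pq_pi (V su.1) su.2 = pq_pi (V su.1) (x su.1) ->
    Fil su.1 (z - su.2) /\ pq_pi (V su.1.+1) z = pq_pi (V su.1.+1) (x su.1.+1).
  move=> [s u] /=; have [uE|nuE] := pselect (pq_pi (V s) u = pq_pi (V s) (x s)); last by exists 0.
  have /pq_piP/VS[b Fb ub] : pq_pi (V s) u = pq_pi (V s) (x s.+1) by rewrite xE.
  exists (u - b) => _; split; first by rewrite addrC addKr; apply: FilN.
  by apply/pq_piP; rewrite addrAC.
pose x' := nat_rect (fun=> P) (x 0%N) (fun s u => next (s, u)).
have x'E s : pq_pi (V s) (x' s) = pq_pi (V s) (x s).
  by elim: s => //= s IH; case: (nextP (s, x' s) IH).
have [|y yE] := @Fil_complete _ _ x'.
  by move=> s; case: (nextP (s, x' s) (x'E s)).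
by exists y => s; rewrite -x'E; apply/pq_piP/FV.
Qed.

(** The codimensions increase and are bounded, hence are maximal at some [B]; from
    there on the projections between the quotients are bijective. *)
Lemma cofinite_chain_stabilises s (U : nat -> ideal P) :
  (forall n, (@Fil k Q s `<=` ideal_set (U n))%classic) ->
  (forall n, (ideal_set (U n.+1) `<=` ideal_set (U n))%classic) ->
  exists B, forall n, (B <= n)%N -> (ideal_set (U B) `<=` ideal_set (U n))%classic.
Proof.
move=> FU US.
have /choice[dc dcP] : forall n, exists dc : {d : nat & {linear P -> 'rV[k]_d}},
    [/\ (tag dc <= #|short_path Q s|)%N, forall y, exists a, tagged dc a = y &
    forall a, tagged dc a = 0 <-> ideal_set (U n) a].
  by move=> n; have [d [c ?]] := quotient_coords (FU n);
  exists (Tagged (fun d => {linear P -> 'rV[k]_d}) c).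
have ex : exists r, `[< exists n, tag (dc n) = r >].
  by exists (tag (dc 0%N)); apply/asboolP; exists 0%N.
have bd r : `[< exists n, tag (dc n) = r >] -> (r <= #|short_path Q s|)%N.
  by move=> /asboolP[n <-]; case: (dcP n).
case: (ex_maxnP ex bd) => r /asboolP[B BE] rmax; exists B => n Bn a UBa.
have /rmax dn : `[< exists m, tag (dc m) = tag (dc n) >] by apply/asboolP; exists n.
have [_ surjn kern] := dcP n; have [_ surjB kerB] := dcP B.
have [p pE] := coord_factor surjn kern kerB
  (fun x => @chain_anti _ (fun n => ideal_set (U n)) US _ _ x Bn).
have /choice[X XE] : forall i, exists x : 'rV_(tag (dc n)), x *m p = delta_mx 0 i.
  move=> i; have [b bE] := surjB (delta_mx 0 i).
  by exists (tagged (dc n) b); rewrite -pE.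
have pfull : (\matrix_i X i) *m p = 1%:M.
  by apply/row_matrixP => i; rewrite row_mul rowK XE row1.
have pfree : row_free p.
  rewrite /row_free eqn_leq rank_leq_row (leq_trans dn) // -BE.
  by rewrite -[X in (X <= _)%N](mxrank1 k) -pfull mxrankM_maxr.
apply/kern/(row_free_inj pfree).
by rewrite mul0mx -pE; apply/kerB.
Qed.

End AddFil.

(** * Comparison of the two limits *)

Section InverseSystem.
Variables (k : fieldType) (Q : quiver).
Notation P := (pathalg k Q).
Variable I : nat -> ideal P.
Hypothesis I_dec : forall n, (ideal_set (I n.+1) `<=` ideal_set (I n))%classic.
Hypothesis I_Fil1 : forall n, (ideal_set (I n) `<=` @Fil k Q 1)%classic.
Hypothesis I_closed : forall n, closed (ideal_set (I n)).
Variable rho : forall n, quot_hom (I n.+1) (I n).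
Hypothesis rho_surj : forall n (y : pathquot (I n)), exists x, rho n x = y.
Implicit Types (a b : P) (x y : invlim rho).

Definition rho_lift n a : P := repr (rho n (pq_pi (I n.+1) a)).

Lemma rho_liftE n a : pq_pi (I n) (rho_lift n a) = rho n (pq_pi (I n.+1) a).
Proof. exact: pq_reprK. Qed.

Lemma qhom_rho_lift n : qhom (I n.+1) (I n) (rho_lift n).
Proof.
split; rewrite ?rho_liftE.
- by move=> a b; rewrite !rho_liftE !rmorphD.
- by move=> a b; rewrite !rho_liftE !rmorphM.
- by rewrite !rmorph1.
- by move=> c a; rewrite !rho_liftE linearZ /= quot_homZ.
- by move=> a /pq_pi0 a0; rewrite rho_liftE a0 rmorph0.
Qed.

(** Defined for all pairs of indices, as the identity when [m <= n], so that
    composites need no casts between the quotients at different levels. *)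
Fixpoint rho_lifts n m a : P :=
  if m is m'.+1 then
    if (n <= m')%N then rho_lifts n m' (rho_lift m' a) else a
  else a.

Lemma rho_liftsnn n a : rho_lifts n n a = a.
Proof. by case: n => //= n; rewrite ltnn. Qed.

Lemma rho_liftsS n m a : (n <= m)%N -> rho_lifts n m.+1 a = rho_lifts n m (rho_lift m a).
Proof. by move=> /= ->. Qed.

Lemma rho_lifts_trans n m l a : (n <= m <= l)%N ->
  rho_lifts n m (rho_lifts m l a) = rho_lifts n l a.
Proof.
move=> /andP[nm /subnK <-]; elim: (l - m)%N a => [|d IH] a.
  by rewrite rho_liftsnn.
by rewrite addSn !rho_liftsS ?IH ?leq_addl // (leq_trans nm) ?leq_addl.
Qed.

Lemma rho_lift_lifts n m a : (n < m)%N -> rho_lift n (rho_lifts n.+1 m a) = rho_lifts n m a.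
Proof.
move=> nm; rewrite -(@rho_lifts_trans n n.+1 m) ?leqnSn //.
by rewrite rho_liftsS // rho_liftsnn.
Qed.

Lemma qhom_rho_lifts n m : (n <= m)%N -> qhom (I m) (I n) (rho_lifts n m).
Proof.
move=> /subnK <-; elim: (m - n)%N => [|d IH].
  have q := @qhom_id _ _ (I n) (I n) (fun _ => id).
  by have -> : rho_lifts n (0 + n) = id by apply/funext => a; rewrite rho_liftsnn.
have := qhom_comp IH (qhom_rho_lift (d + n)).
suff -> : rho_lifts n (d + n) \o rho_lift (d + n) = rho_lifts n (d.+1 + n) by [].
by apply/funext => a; rewrite addSn rho_liftsS ?leq_addl.
Qed.

Lemma rho_lifts_surj n m b : (n <= m)%N ->
  exists a, pq_pi (I n) (rho_lifts n m a) = pq_pi (I n) b.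
Proof.
move=> /subnK <-; elim: (m - n)%N => [|d [a aE]]; first by exists b; rewrite rho_liftsnn.
have [u uE] := rho_surj (pq_pi (I (d + n)) a); exists (repr u).
rewrite addSn rho_liftsS ?leq_addl // -aE; apply: (qhom_pi (qhom_rho_lifts (leq_addl d n))).
by rewrite rho_liftE pq_reprK.
Qed.

Lemma thread_rho x n : rho n (thread x n.+1) = thread x n.
Proof. exact: (threadP x n 1). Qed.

Lemma thread_rho_lifts x n m : (n <= m)%N ->
  pq_pi (I n) (rho_lifts n m (repr (thread x m))) = thread x n.
Proof.
move=> /subnK <-; elim: (m - n)%N => [|d IH]; first by rewrite rho_liftsnn pq_reprK.
rewrite addSn rho_liftsS ?leq_addl // -[RHS]IH.
apply: (qhom_pi (qhom_rho_lifts (leq_addl d n))).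
by rewrite rho_liftE !pq_reprK thread_rho.
Qed.

Lemma exists_invlim (t : forall n, pathquot (I n)) :
  (forall n, rho n (t n.+1) = t n) -> exists x : invlim rho, forall n, thread x n = t n.
Proof.
move=> tP; have comp m d : rho_comp rho (t (d + m)%N) = t m by elim: d => //= d IH; rewrite tP.
by exists (Invlim comp).
Qed.

Lemma I_mono n m : (n <= m)%N -> (ideal_set (I m) `<=` ideal_set (I n))%classic.
Proof. by move=> nm a; apply: (chain_anti I_dec). Qed.

(** The sum makes [N] nondecreasing and at least the index from which
    [I n + Fil s] is constant; the term [s] makes it unbounded. *)
Lemma stable_indices : exists N : nat -> nat,
  [/\ forall s, (s <= N s)%N, forall s, (N s <= N s.+1)%N &
  forall s n, (N s <= n)%N ->
    (ideal_set (addFil (I (N s)) s) `<=` ideal_set (addFil (I n) s))%classic].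
Proof.
have /choice[B BP] : forall s, exists B, forall n, (B <= n)%N ->
    (ideal_set (addFil (I B) s) `<=` ideal_set (addFil (I n) s))%classic.
  move=> s; apply: (@cofinite_chain_stabilises _ _ s (fun n => addFil (I n) s)) => n.
    exact: addFil_Fil.
  exact: addFilS.
exists (fun s => s + \sum_(t < s.+1) B t)%N; split=> [s|s|s n sn].
- exact: leq_addr.
- by rewrite leq_add // [leqRHS]big_ord_recr leq_addr.
have Bs : (B s <= s + \sum_(t < s.+1) B t)%N.
  by rewrite big_ord_recr addnA leq_addl.
move=> a; have /= := @addFilS _ _ _ _ s s (I_mono Bs) (leqnn s) a.
by move=> /[apply]; apply: BP; apply: leq_trans sn.
Qed.

Section Comparison.
Variable N : nat -> nat.
Hypothesis N_ge : forall s, (s <= N s)%N.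
Hypothesis N_mono : forall s, (N s <= N s.+1)%N.
Hypothesis N_stable : forall s n, (N s <= n)%N ->
  (ideal_set (addFil (I (N s)) s) `<=` ideal_set (addFil (I n) s))%classic.

(** The stable value of [I n + Fil s] for large [n]. *)
Definition level s : ideal P := addFil (I (N s)) s.
Definition level_map s : P -> P := rho_lifts (N s) (N s.+1).

Lemma level_dec s : (ideal_set (level s.+1) `<=` ideal_set (level s))%classic.
Proof. by apply: addFilS; [apply: I_mono | apply: leqnSn]. Qed.

Lemma level_succ s a : ideal_set (level s) a ->
  exists2 b, Fil s b & ideal_set (level s.+1) (a - b).
Proof. by move=> /(N_stable (N_mono s))/addFil_succ. Qed.

(** Both the source and the target are the quotient by [level s], although
    [level_map s] starts from [I (N s.+1)]: this ideal and [Fil s] already span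
    [level s]. *)
Lemma level_map_qhom s : qhom (level s) (level s) (level_map s).
Proof.
have q := qhom_addFil s (qhom_rho_lifts (N_mono s)) (@I_Fil1 (N s)).
exact: (qhom_comp q (qhom_id (N_stable (N_mono s)))).
Qed.

Lemma level_map_surj s b : exists a, pq_pi (level s) (level_map s a) = pq_pi (level s) b.
Proof.
have [a aE] := rho_lifts_surj b (N_mono s); exists a.
exact: (pq_piS (@addFil_ideal _ _ _ _) aE).
Qed.

(** Interchanging the two intersections, over [s] and over [n], leaves the closures
    of the [I n]. *)
Lemma level_bigcap a :
  (forall s, ideal_set (level s) a) <-> ideal_set (ideal_bigcap I) a.
Proof.
split=> [Ua n _|Ia s]; last exact/addFil_ideal/Ia.
apply: (closed_addFil (@I_closed n)) => s; exists (maxn n s); first exact: leq_maxr.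
apply: (addFilS _ (leqnn _) (Ua (maxn n s))); apply: I_mono.
by apply: leq_trans (N_ge _); apply: leq_maxl.
Qed.

Lemma level_thread_eq0 x :
  (forall s, ideal_set (level s) (repr (thread x (N s)))) -> x = 0.
Proof.
move=> x0; apply: invlim_ext => n.
rewrite -[thread x n]pq_reprK; apply/pq_pi0; apply: closed_addFil => // s.
exists (maxn n s); first exact: leq_maxr.
have nN : (n <= N (maxn n s))%N by apply: leq_trans (N_ge _); apply: leq_maxl.
have q := qhom_addFil (maxn n s) (qhom_rho_lifts nN) (@I_Fil1 n).
apply/pq_pi0; rewrite -(qhom_ker q (x0 (maxn n s))); symmetry.
by apply: (pq_piS (@addFil_ideal _ _ (I n) _)); rewrite thread_rho_lifts ?pq_reprK.
Qed.

(** The component at [n] of the thread is the limit over [t] of the images of [z t]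
    in the quotient by [I n]; these images agree up to [Fil t], and the limits
    form a thread because each [I n] is closed. *)
Lemma level_threads (z : nat -> P) :
  (forall s, pq_pi (level s) (level_map s (z s.+1)) = pq_pi (level s) (z s)) ->
  exists x, forall s, pq_pi (level s) (repr (thread x (N s))) = pq_pi (level s) (z s).
Proof.
move=> zE.
have step n t : (n <= N t)%N -> pq_pi (addFil (I n) t) (rho_lifts n (N t.+1) (z t.+1)) =
    pq_pi (addFil (I n) t) (rho_lifts n (N t) (z t)).
  move=> nt; rewrite -(@rho_lifts_trans n (N t)) ?nt ?N_mono //.
  exact: (qhom_pi (qhom_addFil t (qhom_rho_lifts nt) (@I_Fil1 n)) (zE t)).
have /choice[w wE] : forall n, exists w, forall j,
    pq_pi (addFil (I n) j) w = pq_pi (addFil (I n) j) (rho_lifts n (N (n + j)) (z (n + j)%N)).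
  move=> n; apply: (@filtered_complete _ _ (fun j => addFil (I n) j)
      (fun j => rho_lifts n (N (n + j)) (z (n + j)%N))).
  - by move=> j; apply: addFil_Fil.
  - by move=> j a; apply: addFil_succ.
  - move=> j; rewrite addnS; have nN : (n <= N (n + j))%N.
      by apply: leq_trans (N_ge _); apply: leq_addr.
    exact: (pq_piS (addFilS (fun _ => id) (leq_addl n j)) (step _ _ nN)).
have [x xE] : exists x : invlim rho, forall n, thread x n = pq_pi (I n) (w n).
  apply: exists_invlim => n; rewrite -rho_liftE; apply/pq_piP.
  apply: closed_addFil => // j; exists j => //; apply/pq_piP.
  have q := qhom_addFil j (qhom_rho_lift n) (@I_Fil1 n).
  rewrite (qhom_pi q (wE n.+1 j)) rho_lift_lifts.
    by rewrite addSnnS (pq_piS (addFilS (fun _ => id) (leqnSn j)) (wE n j.+1)).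
  by apply: leq_trans (N_ge _); rewrite addSn ltnS leq_addr.
exists x => s; transitivity (pq_pi (level s) (w (N s))).
  by apply: (pq_piS (@addFil_ideal _ _ _ _)); rewrite pq_reprK xE.
have lifts_z d : pq_pi (level s) (rho_lifts (N s) (N (s + d)) (z (s + d)%N)) =
    pq_pi (level s) (z s).
  elim: d => [|d IH]; first by rewrite addn0 rho_liftsnn.
  have Nd : (N s <= N (s + d))%N.
    by elim: (d) => [|e le_e]; rewrite ?addn0 // addnS (leq_trans le_e).
  by rewrite addnS -IH (pq_piS (addFilS (fun _ => id) (leq_addr d s)) (step _ _ Nd)).
by rewrite -(lifts_z (N s)) [(s + N s)%N]addnC; apply: wE.
Qed.

End Comparison.

End InverseSystem.

(** With [beta] from [filtered_tower_twist], a thread [x] goes to the element [a] of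
    the path algebra whose class modulo each [level s] is [beta s] of the
    component of [x] at [N s]. *)
Theorem invlim_isomorphic (k : closedFieldType) (Q : quiver)
    (I : nat -> ideal (pathalg k Q)) (rho : forall n, quot_hom (I n.+1) (I n)) :
  (forall n, relation_ideal (I n)) ->
  (forall n, (ideal_set (I n.+1) `<=` ideal_set (I n))%classic) ->
  (forall n (y : pathquot (I n)), exists x, rho n x = y) ->
  exists f : {rmorphism invlim rho -> pathquot (ideal_bigcap I)},
    scalable f /\ bijective f.
Proof.
move=> I_rel I_dec rho_surj.
have I_Fil1 n : (ideal_set (I n) `<=` @Fil k Q 1)%classic.
  by move=> a; apply: relation_ideal_Fil.
have I_closed n : closed (ideal_set (I n)) by case: (I_rel n).
have [N [N_ge N_mono N_stable]] := stable_indices I_dec.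
pose U s := level I N s.
have sub1 s : (ideal_set (U s.+1) `<=` @Fil k Q 1)%classic by apply: addFil_sub1.
have [beta [beta' [qbeta qbeta' betaK beta'K betaS]]] := @filtered_tower_twist _ _ U _
  (fun s => @addFil_Fil _ _ (I (N s)) s) (level_dec I_dec N_mono)
  (level_succ N_mono N_stable) sub1 (level_map_qhom I_Fil1 rho N_mono N_stable)
  (level_map_surj rho_surj N_mono).
have in_level s : (ideal_set (I (N s)) `<=` ideal_set (U s))%classic by apply: addFil_ideal.
pose image (x : invlim rho) a :=
  forall s, pq_pi (U s) a = pq_pi (U s) (beta s (repr (thread x (N s)))).
have image_of (x : invlim rho) u s : pq_pi (I (N s)) u = thread x (N s) ->
    pq_pi (U s) (beta s (repr (thread x (N s)))) = pq_pi (U s) (beta s u).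
  move=> uE; apply: (qhom_pi (qbeta s)); apply: (pq_piS (in_level s)).
  by rewrite uE pq_reprK.
have image_ex x : exists a, image x a.
  apply: (@filtered_complete _ _ U (fun s => beta s (repr (thread x (N s))))).
  - by move=> s; apply: addFil_Fil.
  - exact: (level_succ N_mono N_stable).
  - move=> s; rewrite betaS; symmetry; apply: image_of.
    exact: thread_rho_lifts.
have image_uniq x a b : image x a -> image x b ->
    pq_pi (ideal_bigcap I) a = pq_pi (ideal_bigcap I) b.
  move=> xa xb; apply/pq_piP/(level_bigcap I_dec I_closed N_ge) => s.
  by apply/pq_piP; rewrite xa xb.
pose f x : pathquot (ideal_bigcap I) := pq_pi _ (sval (cid (image_ex x))).
have fE x a : image x a -> f x = pq_pi (ideal_bigcap I) a.
  exact/image_uniq/(svalP (cid (image_ex x))).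
have fP x : exists2 a, image x a & f x = pq_pi _ a.
  by have [a xa] := image_ex x; exists a => //; apply: fE.
have f_zmod : zmod_morphism f.
  move=> x y; have [a xa ->] := fP x; have [b yb ->] := fP y.
  rewrite -raddfB; apply: fE => s.
  rewrite -scaleN1r (image_of _ (repr (thread x (N s)) + (-1) *: repr (thread y (N s)))).
    by rewrite (qhomD (qbeta s)) (qhomZ (qbeta s)) raddfD /= linearZ /= xa yb.
  by rewrite raddfD /= linearZ /= !pq_reprK scaleN1r.
have f_surj y : exists x, f x = y.
  pose a := repr y; have [|x xE] := @level_threads _ _ I I_Fil1 I_closed rho N N_ge N_mono
     (fun s => beta' s a).
    move=> s; rewrite -beta'K -[RHS]beta'K; apply: (qhom_pi (qbeta' s)).
    rewrite -betaS betaK; apply: (pq_piS (@level_dec _ _ _ I_dec _ N_mono s)).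
    exact: betaK.
  exists x; rewrite -[y]pq_reprK; apply: fE => s.
  by rewrite (qhom_pi (qbeta s) (xE s)) betaK.
have f_mul : {morph f : x y / x * y}.
  move=> x y; have [a xa ->] := fP x; have [b yb ->] := fP y.
  rewrite -rmorphM; apply: fE => s.
  rewrite (image_of _ (repr (thread x (N s)) * repr (thread y (N s)))).
    by rewrite (qhomM (qbeta s)) rmorphM /= xa yb.
  by rewrite rmorphM /= !pq_reprK.
have f_one : f 1 = 1.
  rewrite -(rmorph1 (pq_pi _)); apply: fE => s.
  by rewrite (image_of _ 1) ?(qhom1 (qbeta s)) rmorph1.
have f_scale : scalable f.
  move=> c x; have [a xa ->] := fP x; rewrite -linearZ; apply: fE => s.
  rewrite (image_of _ (c *: repr (thread x (N s)))).
    by rewrite (qhomZ (qbeta s)) linearZ /= xa.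
  by rewrite linearZ /= pq_reprK.
pose fadd := GRing.isZmodMorphism.Build _ _ f f_zmod.
pose fmul := GRing.isMonoidMorphism.Build _ _ f (f_one, f_mul).
pose F : {rmorphism invlim rho -> pathquot (ideal_bigcap I)} := HB.pack f fadd fmul.
exists F; split; first exact: f_scale.
have f_ker x : f x = 0 -> x = 0.
  have [a xa ->] := fP x => /pq_pi0/(level_bigcap I_dec I_closed N_ge) Ua.
  apply: (level_thread_eq0 I_Fil1 I_closed N_ge) => s; apply/pq_pi0.
  by rewrite -beta'K -(qhom_pi (qbeta' s) (xa s)) (qhom_ker (qbeta' s)).
have f_inj : injective f.
  by move=> x y fxy; apply/subr0_eq/f_ker; rewrite f_zmod fxy subrr.
have /choice[g gK] := f_surj.
by exists g => // x; apply: f_inj; apply: gK.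
Qed.

Theorem proposition2p6 (k : closedFieldType) (p : nat) (hp : p \in [pchar k]%R)
  (Q : quiver) (I : nat -> ideal (pathalg k Q))
  (hI : forall n : nat, relation_ideal (I n))
  (hdec : forall n : nat, (ideal_set (I n.+1) `<=` ideal_set (I n))%classic)
  (rho : forall n : nat, quot_hom (I n.+1) (I n))
  (hrho : forall (n : nat) (y : pathquot (I n)), exists x, rho n x = y) :
  exists f : {rmorphism invlim rho -> pathquot (ideal_bigcap I)},
    scalable f /\ bijective f.
Proof. exact: invlim_isomorphic. Qed.
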